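(* Let $W$ be a standard Brownian motion, let $(T_t)_{t\ge 0}$ be a continuous random time change independent of $W$ with $T_0=0$ and $T_t<\infty$ for all $t$, and let $X_t=W_{T_t}$, $t\ge 0$. With $\psi$, $[X]^n$, $C$ and $C^n$ as defined in the context, let $t_0\ge 0$ be such that $\mathbb{P}(T_{t_0}>0)=1$. Then for all $u,v\in[0,1]$, all $\mathscr{T}>t_0$ and all $\varepsilon>0$, $$\mathbb{P}\left(\sup_{t_0\le s,t\le \mathscr{T}}\left|C(s,t;u,v)-C^n(s,t;u,v)\right|\ge\varepsilon\right)\longrightarrow 0,\qquad n\to\infty.$$
   Context: All processes live on a filtered probability space $(\Omega,\mathcal{F},(\mathcal{F}_t)_{t\ge0},\mathbb{P})$ satisfying the usual conditions of right-continuity and completeness. A continuous random time change is a non-decreasing process $(T_t)_{t\ge0}$ with continuous paths and values in $[0,\infty]$ such that each $T_t$ is an $(\mathcal{F}_t)_{t\ge 0}$-stopping time. Let $\Phi$ be the cdf of the standard normal distribution, with $\Phi^{-1}(0)=-\infty$, $\Phi^{-1}(1)=+\infty$, $\Phi(-\infty)=0$, $\Phi(+\infty)=1$. For $s,t\ge0$ and $u,v\in[0,1]$ define $$\psi(s,t;u,v):=\begin{cases}\displaystyle\int_0^u\Phi\left(\frac{\sqrt{t\lor s}\,\Phi^{-1}(v)-\sqrt{s\land t}\,\Phi^{-1}(w)}{\sqrt{|t-s|}}\right)dw,& |t-s|>0,\\ u\land v,& t=s>0,\\ uv,&\text{otherwise.}\end{cases}$$ The conditional copula associated to $X$ is $C(s,t;u,v):=\psi(T_s,T_t;u,v)$.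 For $n\in\mathbb{N}$, the realized variation of $X$ is $[X]^n_t:=\sum_{i=1}^{[nt]}(X_{i/n}-X_{(i-1)/n})^2$, $t\ge0$, where $[x]$ is the integer part of $x$. The estimator is $C^n(s,t;u,v):=\psi([X]^n_s,[X]^n_t;u,v)$. *)

(* Defs.v *)
From HB Require Import structures.
From mathcomp Require Import all_boot all_order all_algebra.
From mathcomp Require Import all_classical all_reals all_analysis.
From mathcomp Require Import measurable_realfun.

Set Implicit Arguments.
Unset Strict Implicit.
Unset Printing Implicit Defensive.

Import Order.TTheory GRing.Theory Num.Theory.
Import numFieldNormedType.Exports.

Local Open Scope classical_set_scope.
Local Open Scope ring_scope.

(* Processes are indexed by R with junk at negative times: every condition
   below is restricted to times >= 0. *)

Definition filtration (d : measure_display) (Om : measurableType d)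
    (R : realType) (F : R -> set (set Om)) : Prop :=
  (forall t, 0 <= t -> sigma_algebra setT (F t) /\ F t `<=` measurable) /\
  (forall s t, 0 <= s -> s <= t -> F s `<=` F t).

(* The second clause also makes P itself complete, since F 0 `<=` measurable. *)
Definition usual_conditions (d : measure_display) (Om : measurableType d)
    (R : realType) (P : probability Om R) (F : R -> set (set Om)) : Prop :=
  (forall t, 0 <= t -> \bigcap_(s in [set s | t < s]) F s `<=` F t) /\
  P.-negligible `<=` F 0.

Definition stopping_time (d : measure_display) (Om : measurableType d)
    (R : realType) (F : R -> set (set Om)) (tau : Om -> \bar R) : Prop :=
  (forall w, (0 <= tau w)%E) /\
  (forall s, 0 <= s -> F s [set w | (tau w <= s%:E)%E]).

Definition continuous_time_change (d : measure_display)
    (Om : measurableType d) (R : realType) (P : probability Om R)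
    (F : R -> set (set Om)) (T : R -> Om -> \bar R) : Prop :=
  [/\ forall t, 0 <= t -> stopping_time F (T t),
      {ae P, forall w, forall s t, 0 <= s -> s <= t -> (T s w <= T t w)%E} &
      {ae P, forall w, {within `[0, +oo[, continuous (fun t : R => T t w)}}].

Definition sigma_process (d d' : measure_display) (Om : measurableType d)
    (E : measurableType d') (R : realType) (J : set R) (Y : R -> Om -> E) :
    set (set Om) :=
  <<s \bigcup_(i in J) preimage_set_system setT (Y i) measurable >>.

Definition independent (d : measure_display) (Om : measurableType d)
    (R : realType) (P : probability Om R) (G H : set (set Om)) : Prop :=
  forall A B, G A -> H B -> P (A `&` B) = (P A * P B)%E.

(* The second parameter of [normal_prob] is the standard deviation. *)
Definition standard_brownian_motion (d : measure_display)
    (Om : measurableType d) (R : realType) (P : probability Om R)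
    (W : R -> Om -> R) : Prop :=
  [/\ forall t, 0 <= t -> measurable_fun setT (W t),
      {ae P, forall w, W 0 w = 0},
      forall s t, 0 <= s -> s < t ->
        independent P (sigma_process `[0, s] W)
          (preimage_set_system setT (fun w => W t w - W s w) measurable),
      forall s t, 0 <= s -> s < t -> forall A, measurable A ->
        P ((fun w => W t w - W s w) @^-1` A)
          = normal_prob 0 (Num.sqrt (t - s)) A &
      {ae P, forall w, {within `[0, +oo[, continuous (fun t : R => W t w)}}].

Definition independent_processes (d d1 d2 : measure_display)
    (Om : measurableType d) (E1 : measurableType d1) (E2 : measurableType d2)
    (R : realType) (P : probability Om R)
    (Y : R -> Om -> E1) (Z : R -> Om -> E2) : Prop :=
  independent P (sigma_process `[0, +oo[ Y) (sigma_process `[0, +oo[ Z).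

(* X_t = W_{T_t}; [fine] only matters where T_t is infinite. *)
Definition time_changed (Om : Type) (R : realType)
    (W : R -> Om -> R) (T : R -> Om -> \bar R) (t : R) (w : Om) : R :=
  W (fine (T t w)) w.

Definition Phi (R : realType) (x : \bar R) : R :=
  match x with
  | r%:E => fine (normal_prob 0 1 `]-oo, r])
  | +oo%E => 1
  | -oo%E => 0
  end.

(* Used on [0, 1] only; on the open interval it is the unique real preimage. *)
Definition Phi_inv (R : realType) (p : R) : \bar R :=
  if p == 0 then -oo%E
  else if p == 1 then +oo%E
  else (xget 0 [set x : R | Phi x%:E = p])%:E.

(* The quotient is an extended real. When v is 0 or 1 it can be of the form
   oo - oo, but only at w = 0 or w = 1, which the integral does not see. *)
Definition psi (R : realType) (s t u v : R) : R :=
  if 0 < `|t - s| then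
    (\int[lebesgue_measure]_(w in `[0, u])
      Phi (((Num.sqrt (Num.max t s))%:E * Phi_inv v
            - (Num.sqrt (Num.min s t))%:E * Phi_inv w)
           * ((Num.sqrt `|t - s|)^-1)%:E)%E)
  else if (t == s) && (0 < s) then Num.min u v
  else u * v.

Definition cond_copula (Om : Type) (R : realType) (T : R -> Om -> \bar R)
    (s t u v : R) (w : Om) : R :=
  psi (fine (T s w)) (fine (T t w)) u v.

(* [Num.truncn] is the integer part, since n t >= 0. *)
Definition realized_variation (Om : Type) (R : realType) (X : R -> Om -> R)
    (n : nat) (t : R) (w : Om) : R :=
  \sum_(1 <= i < (Num.truncn (n%:R * t)).+1)
    (X (i%:R / n%:R) w - X (i.-1%:R / n%:R) w) ^+ 2.

Definition copula_estimator (Om : Type) (R : realType) (X : R -> Om -> R)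
    (n : nat) (s t u v : R) (w : Om) : R :=
  psi (realized_variation X n s w) (realized_variation X n t w) u v.

(* Main.v *)
Require Import Defs.
From HB Require Import structures.
From mathcomp Require Import all_boot all_order all_algebra.
From mathcomp Require Import all_classical all_reals all_analysis.
From mathcomp Require Import measurable_realfun ring lra zify.
Import Order.TTheory GRing.Theory Num.Theory.
Import numFieldNormedType.Exports.
Local Open Scope classical_set_scope.
Local Open Scope ring_scope.

Set Implicit Arguments.
Unset Strict Implicit.
Unset Printing Implicit Defensive.

(** Why the estimator is consistent.

    Dividing numerator and denominator by the square root of the larger clock
    shows that, unless both clocks vanish, psi s t u v depends on s and t only
    through the ratio r of the smaller one to the larger one.  As a function
    of r it is the integral over w in ]0, u[ of
    Phi ((q v - sqrt r * q w) / sqrt (1 - r)), where q is the normal quantile.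
    When r tends to 1 the integrand tends to 1 for w < v and to 0 for w > v,
    so the integral tends to min u v, the value that psi takes on the
    diagonal.  Hence psi is continuous away from the origin, and even
    uniformly continuous on the pairs of clocks the larger of which exceeds a
    given positive level ([psi_uniformly_continuous]).  Since T t0 > 0 almost
    surely, T is above such a level on [t0, tmax] with probability close to 1,
    and the theorem is reduced to the convergence of the realized variation to
    T, uniformly on [0, tmax] and in probability ([realized_variation_ucp]).

    At a fixed time this convergence is a second moment computation.  For a
    deterministic clock tau, the variables
    (W (tau i.+1) - W (tau i)) ^ 2 - (tau i.+1 - tau i) are centred, and each is
    independent of the sum of the preceding ones, so that the second moment of
    their sum is the sum of 2 * (tau i.+1 - tau i) ^ 2
    ([second_moment_centered_sum]).  That is at most twice the largest
    increment times the total time, which vanishes as the partition is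
    refined because the clock is continuous.  The random clock is independent
    of W, so the bound applies conditionally on it.  Conditioning is kept
    elementary: the clock is rounded down to multiples of 1 / k.+1, so that
    its values on the partition form a countably valued random vector, on each
    atom of which independence applies directly; then k tends to infinity,
    using the continuity of the paths of W ([tail_increments]).

    Uniformity in time is Dini's argument: the realized variation and the
    clock are both nondecreasing, so it is enough to control their difference
    on a finite grid over which the clock has small increments.

    Finally, the event of the theorem is a supremum over uncountably many
    times, and P is only meaningful on measurable sets.  Off a null set the
    clock is continuous and the realized variation is a right-continuous step
    function, so the supremum may be taken over rational times; completeness
    then gives measurability ([measurable_copula_deviation]). *)

(** * The standard normal distribution function and its quantile *)

Section Phi_theory.
Context {R : realType}.
Notation mu := (@lebesgue_measure R).
Notation N01 := (normal_prob (0 : R) 1).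

Lemma Phi_EFinE (x : R) : (Phi x%:E)%:E = N01 `]-oo, x].
Proof. by rewrite /Phi fineK// fin_num_measure. Qed.

Lemma Phi_ge0 (x : \bar R) : 0 <= Phi x.
Proof. by case: x => //= r; rewrite fine_ge0. Qed.

Lemma Phi_le1 (x : \bar R) : Phi x <= 1.
Proof.
case: x => [r| |]//; rewrite -lee_fin Phi_EFinE.
exact: probability_le1.
Qed.

Lemma Phi_nondecreasing : {homo (fun x : R => Phi x%:E) : x y / x <= y}.
Proof.
move=> x y xy; rewrite -lee_fin !Phi_EFinE le_measure ?inE//.
exact: subitvPr.
Qed.

(** The density is bounded by its peak, and this is all that the continuity of
    Phi rests on. *)
Lemma Phi_lipschitz (x y : R) : x <= y ->
  Phi y%:E - Phi x%:E <= normal_peak 1 * (y - x).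
Proof.
move=> xy; rewrite lerBlDr -lee_fin EFinD !Phi_EFinE.
have -> : `]-oo, y]%classic = `]x, y]%classic `|` `]-oo, x]%classic.
  by rewrite setUC -itv_bndbnd_setU.
apply: le_trans (measureU2 _ _ _) _ => //.
apply: leeD => //.
rewrite /normal_prob.
apply: (@le_trans _ _ (\int[mu]_(_ in `]x, y]) (normal_peak (1 : R))%:E)%E).
  apply: ge0_le_integral => //.
  - by move=> z _; rewrite lee_fin normal_pdf_ge0.
  - apply/measurable_EFinP/measurable_funTS; exact: measurable_normal_pdf.
  - by move=> z _; rewrite lee_fin normal_pdf_ub// oner_eq0.
rewrite integral_cst//= lebesgue_measure_itv/= lte_fin.
case: ifPn => _; first by rewrite -EFinB -EFinM.
by rewrite mule0 lee_fin mulr_ge0 ?normal_peak_ge0// subr_ge0.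
Qed.

Lemma continuous_Phi : continuous (fun x : R => Phi x%:E).
Proof.
have p0 : 0 < normal_peak (1 : R) by rewrite normal_peak_gt0 ?oner_eq0.
move=> x; apply/cvgrPdist_le => e e0; near=> y.
apply: (@le_trans _ _ (normal_peak 1 * `|x - y|)); last first.
  rewrite mulrC -ler_pdivlMr//; near: y.
  have /cvgrPdist_le : z @[z --> x] --> x by exact: cvg_id.
  by apply; rewrite divr_gt0.
have [xy|/ltW yx] := leP x y.
  by rewrite distrC (distrC x) !ger0_norm ?subr_ge0 ?Phi_nondecreasing ?Phi_lipschitz.
by rewrite !ger0_norm ?subr_ge0 ?Phi_nondecreasing ?Phi_lipschitz.
Unshelve. all: end_near. Qed.

Let idTR : measurableTypeR R -> R := idfun.

#[local] HB.instance Definition _ :=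
  @isMeasurableFun.Build _ _ _ _ idTR (@measurable_id _ _ setT).

Lemma Phi_cvg_pinfty : Phi x%:E @[x --> +oo] --> (1 : R).
Proof.
have := @cvg_cdfy1 _ _ _ N01 (idTR : {RV N01 >-> R}).
move=> /fine_cvg; apply: cvg_trans; apply: near_eq_cvg.
by near=> x.
Unshelve. all: end_near. Qed.

Lemma Phi_cvg_ninfty : Phi x%:E @[x --> -oo] --> (0 : R).
Proof.
have := @cvg_cdfNy0 _ _ _ N01 (idTR : {RV N01 >-> R}).
move=> /fine_cvg; apply: cvg_trans; apply: near_eq_cvg.
by near=> x.
Unshelve. all: end_near. Qed.

(** Any preimage under Phi will do, and Phi_inv picks this one on ]0, 1[
    ([Phi_invE]); keeping it real avoids arithmetic with infinities. *)
Definition quantile (w : R) : R := xget 0 [set x : R | Phi x%:E = w].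

Lemma Phi_quantile (w : R) : 0 < w < 1 -> Phi (quantile w)%:E = w.
Proof.
move=> /andP[w0 w1].
rewrite /quantile; case: xgetP => [y _ //|].
suff [x xw] : exists x, Phi x%:E = w by move=> /(_ x).
have [b bw] : exists b, w < Phi b%:E.
  have := Phi_cvg_pinfty => /cvgrPdist_lt /(_ (1 - w)).
  rewrite subr_gt0 => /(_ w1) [M [_ HM]].
  exists (M + 1); have := HM (M + 1); rewrite ltrDl => /(_ ltr01).
  by rewrite ger0_norm ?subr_ge0 ?Phi_le1// ltrD2l ltrN2.
have [a aw] : exists a, Phi a%:E < w.
  have := Phi_cvg_ninfty => /cvgrPdist_lt /(_ w w0) [M [_ HM]].
  exists (M - 1); have := HM (M - 1); rewrite gtrBl => /(_ ltr01).
  by rewrite sub0r normrN ger0_norm ?Phi_ge0.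
have ab : a <= b.
  rewrite leNgt; apply/negP => /ltW /Phi_nondecreasing.
  by rewrite leNgt (lt_trans aw bw).
have [||c _ <-] := @IVT R (fun x => Phi x%:E) a b w ab.
- by apply: continuous_subspaceT; exact: continuous_Phi.
- by rewrite ge_min (ltW aw) le_max (ltW bw) orbT.
- by exists c.
Qed.

(** Otherwise the nondecreasing Phi would give w' <= w. *)
Lemma quantile_lt (w w' : R) : 0 < w < 1 -> 0 < w' < 1 -> w < w' ->
  quantile w < quantile w'.
Proof.
move=> w01 w'01 ww'; rewrite ltNge; apply/negP => /Phi_nondecreasing.
by rewrite !Phi_quantile// leNgt ww'.
Qed.

Lemma Phi_invE (w : R) : 0 < w < 1 -> Phi_inv w = (quantile w)%:E.
Proof. by move=> /andP[w0 w1]; rewrite /Phi_inv gt_eqF// lt_eqF. Qed.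

(** By monotonicity, the preimage of a half-line is an interval. *)
Lemma measurable_quantile (u : R) : u <= 1 -> measurable_fun `]0, u[ quantile.
Proof.
move=> u1.
apply: (measurability _ (RGenCInfty.measurableE R)) => _ [_ [r] -> <-].
apply: is_interval_measurable => x y /= [].
rewrite !in_itv/= !andbT => /andP[x0 xu] xr [/andP[y0 yu] yr] z /andP[xz zy].
have z0 := lt_le_trans x0 xz.
have zu := le_lt_trans zy yu.
split; first by rewrite /= in_itv/= z0 zu.
rewrite in_itv/= andbT (le_trans xr)//.
move: xz; rewrite [x <= z]le_eqVlt => /orP[/eqP->//|xz].
by apply/ltW/quantile_lt => //; rewrite ?x0 ?z0/= (lt_le_trans _ u1)//.
Qed.

End Phi_theory.

(** * The copula as a function of the ratio of the clocks *)

Section psi_theory.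
Context {R : realType}.
Notation mu := (@lebesgue_measure R).

Lemma Rintegral_itv_cc_oo (a b : R) (f : R -> R) : measurable_fun `]a, b[ f ->
  (\int[mu]_(x in `[a, b]) f x = \int[mu]_(x in `]a, b[) f x)%R.
Proof.
move=> mf; rewrite /Rintegral.
rewrite -integral_itv_obnd_cbnd; last first.
  by apply/measurable_EFinP/measurable_fun_itv_bndo_bndcP.
by rewrite -integral_itv_bndo_bndc//; exact/measurable_EFinP.
Qed.

(** The integrand of psi, both clocks being divided by the larger one; r is
    their ratio, and the value for r >= 1 is the limit as r increases to 1.
    Since sqrt vanishes on the negative numbers, the kernel is continuous in r
    on the whole line, hence on an open interval containing [0, 1]. *)
Definition copula_kernel (v r w : R) : R :=
  if r < 1 then
    Phi ((quantile v - Num.sqrt r * quantile w) / Num.sqrt (1 - r))%:E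
  else (w < v)%R%:R.

Definition copula_ratio (u v r : R) : R :=
  (\int[mu]_(w in `]0%R, u[) copula_kernel v r w)%R.

Lemma copula_kernel_ge0 (v r w : R) : 0 <= copula_kernel v r w.
Proof. by rewrite /copula_kernel; case: ifP => // _; exact: Phi_ge0. Qed.

Lemma copula_kernel_le1 (v r w : R) : copula_kernel v r w <= 1.
Proof.
rewrite /copula_kernel; case: ifP => // _; first exact: Phi_le1.
by case: (_ < _); rewrite ?ler01.
Qed.

Lemma measurable_copula_kernel (u v r : R) : u <= 1 ->
  measurable_fun `]0, u[ (copula_kernel v r).
Proof.
move=> u1; have [r1|r1] := ltP r 1; last first.
  have -> : copula_kernel v r = \1_(`]-oo, v[%classic).
    apply/funext => w; rewrite /copula_kernel ltNge r1/= indicE; congr (_%:R).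
    by apply/esym; rewrite mem_setE in_itv.
  by apply: measurable_funTS; exact: measurable_indic.
have -> : copula_kernel v r = (fun x : R => Phi x%:E) \o
    (fun w => (quantile v - Num.sqrt r * quantile w) / Num.sqrt (1 - r)).
  by apply/funext => w; rewrite /copula_kernel r1.
apply: measurableT_comp.
  by apply: continuous_measurable_fun; exact: continuous_Phi.
apply: measurable_funM => //; apply: measurable_funB => //.
by apply: measurable_funM => //; exact: measurable_quantile.
Qed.

(** The point that matters is r = 1: there the numerator tends to
    quantile v - quantile w, which has the sign of v - w, while the denominator
    tends to 0, so that the argument of Phi tends to +oo or -oo. *)
Lemma continuous_copula_kernel (v w : R) : 0 < v < 1 -> 0 < w < 1 -> w != v ->
  continuous (copula_kernel v ^~ w).
Proof.
move=> v01 w01 wv r0.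
pose z (r : R) := (quantile v - Num.sqrt r * quantile w) / Num.sqrt (1 - r).
have cnum (r : R) : (quantile v - Num.sqrt r' * quantile w) @[r' --> r]
    --> quantile v - Num.sqrt r * quantile w.
  apply: cvgB; first exact: cvg_cst.
  by apply: cvgM; [exact: sqrt_continuous|exact: cvg_cst].
have cden (r : R) : Num.sqrt (1 - r') @[r' --> r] --> Num.sqrt (1 - r).
  have h : (1 - r') @[r' --> r] --> 1 - r by apply: cvgB; [exact: cvg_cst|exact: cvg_id].
  exact: (cvg_comp _ _ h (@sqrt_continuous R (1 - r))).
have [r01|r01|r01] := ltgtP r0 1.
- have cz : {for r0, continuous z}.
    apply: cvgM; first exact: cnum.
    apply: cvgV; last exact: cden.
    by rewrite gt_eqF// sqrtr_gt0 subr_gt0.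
  have : Phi (z r)%:E @[r --> r0] --> Phi (z r0)%:E.
    exact: (cvg_comp _ _ cz (@continuous_Phi R (z r0))).
  rewrite /continuous_at {2}/copula_kernel r01.
  apply: cvg_trans; apply: near_eq_cvg; near=> r.
  rewrite /copula_kernel ifT//; near: r; exact: lt_nbhsl.
- rewrite /continuous_at {2}/copula_kernel ltNge ltW//=.
  apply: cvg_near_cst; near=> r.
  rewrite /copula_kernel ltNge ltW//=; near: r; exact: lt_nbhsr.
- rewrite r01 /continuous_at {2}/copula_kernel ltxx.
  apply/cvgrPdist_le => e e0.
  have c1 : Num.sqrt (1 - r') @[r' --> (1 : R)] --> (0 : R).
    by have := cden 1; rewrite subrr sqrtr0.
  have c2 : (quantile v - Num.sqrt r' * quantile w) @[r' --> (1 : R)] -->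
      quantile v - quantile w.
    by have := cnum 1; rewrite sqrtr1 mul1r.
  case: ltgtP wv => // wv _.
  + have qd : 0 < (quantile v - quantile w) / 2.
      by rewrite divr_gt0// subr_gt0 quantile_lt.
    have /cvgrPdist_lt /(_ _ e0) [M [_ HM]] := @Phi_cvg_pinfty R.
    have M0 : 0 < `|M| + 1 by rewrite ltr_wpDl.
    near=> r; rewrite /copula_kernel; case: ifPn => r1; last by rewrite wv subrr normr0 ltW.
    apply/ltW/HM.
    have s0 : 0 < Num.sqrt (1 - r) by rewrite sqrtr_gt0 subr_gt0.
    rewrite ltr_pdivlMr//.
    apply: (@lt_trans _ _ ((quantile v - quantile w) / 2)).
      rewrite (@le_lt_trans _ _ ((`|M| + 1) * Num.sqrt (1 - r)))//.
        by rewrite ler_pM2r// (le_trans (ler_norm _))// lerDl.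
      rewrite -ltr_pdivlMl// mulrC; near: r.
      by apply: cvgr_lt c1 _ _; rewrite divr_gt0.
    near: r; apply: cvgr_gt c2 _ _.
    by rewrite ltr_pdivrMr// mulr_natr mulr2n ltrDl subr_gt0 quantile_lt.
  + have qd : 0 < (quantile w - quantile v) / 2.
      by rewrite divr_gt0// subr_gt0 quantile_lt.
    have /cvgrPdist_lt /(_ _ e0) [M [_ HM]] := @Phi_cvg_ninfty R.
    have M0 : 0 < `|M| + 1 by rewrite ltr_wpDl.
    near=> r; rewrite /copula_kernel; case: ifPn => r1.
      apply/ltW/HM.
      have s0 : 0 < Num.sqrt (1 - r) by rewrite sqrtr_gt0 subr_gt0.
      rewrite ltr_pdivrMr//.
      apply: (@lt_trans _ _ ((quantile v - quantile w) / 2)).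
        near: r; apply: cvgr_lt c2 _ _.
        by rewrite ltr_pdivlMr// mulr_natr mulr2n gtrDl subr_lt0 quantile_lt.
      rewrite -(opprB (quantile w)) mulNr ltrNl -mulNr.
      rewrite (@le_lt_trans _ _ ((`|M| + 1) * Num.sqrt (1 - r)))//.
        by rewrite ler_pM2r// (le_trans (ler_norm _))// normrN lerDl.
      rewrite -ltr_pdivlMl// mulrC; near: r.
      by apply: cvgr_lt c1 _ _; rewrite divr_gt0.
    by rewrite (lt_gtF wv) subrr normr0 ltW.
Unshelve. all: end_near. Qed.

Lemma integrable_unit_bounded (u : R) (f : R -> R) : u <= 1 ->
  measurable_fun `]0, u[ f -> (forall w, 0 <= f w <= 1) ->
  mu.-integrable `]0, u[ (EFin \o f).
Proof.
move=> u1 mf f01.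
apply: measurable_bounded_integrable => //.
  by rewrite /= lebesgue_measure_itv/=; case: ifPn => _; rewrite ltry.
exists 1; split => // x x1 w _; have /andP[f0 f1] := f01 w.
by rewrite /= ger0_norm// (le_trans f1)// ltW.
Qed.

(** Dominated convergence, with dominating constant 1 and exceptional set
    {v}. *)
Lemma continuous_copula_ratio (u v : R) : u <= 1 -> 0 < v < 1 ->
  {in `](-1), 2[%classic, continuous (copula_ratio u v)}.
Proof.
move=> u1 v01; rewrite /copula_ratio.
apply: (@continuity_under_integral R _ _ mu (copula_kernel v) _ _ _ _ _ _ (cst 1)) => //.
- move=> r _; apply: integrable_unit_bounded => //; first exact: measurable_copula_kernel.
  by move=> w; rewrite copula_kernel_ge0 copula_kernel_le1.
- exists [set v]; split => //; first exact: lebesgue_measure_set1.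
  move=> w; apply: contra_notP => /eqP wv /=; rewrite in_itv/= => /andP[w0 wu] r _.
  apply: continuous_copula_kernel => //.
  by rewrite w0 (lt_le_trans wu).
- by apply: integrable_unit_bounded => //= w; rewrite ler01 lexx.
- move=> r _; apply: aeW => w _.
  by rewrite ger0_norm ?copula_kernel_ge0// copula_kernel_le1.
Qed.

Lemma copula_ratio1 (u v : R) : 0 <= u <= 1 -> 0 < v < 1 ->
  copula_ratio u v 1 = Num.min u v.
Proof.
move=> /andP[u0 u1] /andP[v0 v1]; rewrite /copula_ratio.
under eq_Rintegral do rewrite /copula_kernel ltxx.
have -> : (fun w => (w < v)%R%:R : R) = \1_(`]-oo, v[%classic).
  apply/funext => w; rewrite indicE; congr (_%:R).
  by apply/esym; rewrite mem_setE in_itv.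
rewrite /Rintegral integral_indic//.
have -> : `]-oo, v[%classic `&` `]0, u[%classic = `]0, Num.min u v[%classic.
  apply/seteqP; split => w /=; rewrite !in_itv/= lt_min.
    by move=> [-> /andP[-> ->]].
  by move=> /and3P[-> -> ->].
rewrite /= lebesgue_measure_itv/= lte_fin.
case: ifPn => [_|]; first by rewrite oppr0 addr0.
rewrite -leNgt => h; apply/le_anti; rewrite h andbT.
by rewrite le_min u0 ltW.
Qed.

Lemma psi_ratio_aux (u v s t : R) : 0 <= u <= 1 -> 0 < v < 1 ->
  0 <= s -> 0 <= t -> 0 < Num.max s t ->
  psi s t u v = copula_ratio u v (Num.min s t / Num.max s t).
Proof.
move=> u01 v01 s0 t0 M0; rewrite /psi.
have [ts|ts] := eqVneq t s.
  rewrite ts subrr normr0 ltxx ?eqxx /=.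
  move: M0; rewrite ts maxxx minxx => M0.
  by rewrite M0 divff ?gt_eqF// copula_ratio1.
have d0 : 0 < `|t - s| by rewrite normr_gt0 subr_eq0.
rewrite d0; case/andP: u01 => u0 u1.
pose r := Num.min s t / Num.max s t.
have M'0 : Num.max s t != 0 by rewrite gt_eqF.
have m0 : 0 <= Num.min s t by rewrite le_min s0.
have dE : `|t - s| = Num.max s t * (1 - r).
  rewrite /r mulrBr mulr1 mulrC divfK//.
  case: (leP s t) => st; first by rewrite ger0_norm ?subr_ge0.
  by rewrite ltr0_norm ?subr_lt0// opprB.
have r1 : r < 1 by move: d0; rewrite dE pmulr_rgt0// subr_gt0.
have r0 : 0 <= r by rewrite divr_ge0// ltW.
have E w : 0 < w < 1 -> Phi (((Num.sqrt (Num.max t s))%:E * Phi_inv v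
            - (Num.sqrt (Num.min s t))%:E * Phi_inv w)
           * ((Num.sqrt `|t - s|)^-1)%:E)%E = copula_kernel v r w.
  move=> w01; rewrite /copula_kernel r1 !Phi_invE// -!EFinM.
  congr (Phi _%:E); rewrite dE maxC sqrtrM ?(ltW M0)//.
  have -> : Num.min s t = Num.max s t * r by rewrite /r mulrC divfK.
  rewrite sqrtrM ?(ltW M0)//.
  have sM : Num.sqrt (Num.max s t) != 0 by rewrite gt_eqF// sqrtr_gt0.
  have s1 : Num.sqrt (1 - r) != 0 by rewrite gt_eqF// sqrtr_gt0 subr_gt0.
  by field; rewrite sM s1.
have E' : {in `]0, u[%classic, (fun w => Phi (((Num.sqrt (Num.max t s))%:E * Phi_inv v
            - (Num.sqrt (Num.min s t))%:E * Phi_inv w)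
           * ((Num.sqrt `|t - s|)^-1)%:E)%E) =1 copula_kernel v r}.
  move=> w; rewrite inE/= in_itv/= => /andP[w0 wu].
  by apply: E; rewrite w0 (lt_le_trans wu).
rewrite Rintegral_itv_cc_oo; first exact: eq_Rintegral.
apply: (eq_measurable_fun (copula_kernel v r)); last exact: measurable_copula_kernel.
by move=> w wu; rewrite E'.
Qed.

(** For v = 0 and v = 1 the quantile is infinite, so these values are treated
    apart: psi is then the constant 0, respectively u. *)
Lemma psi_ratio (u v : R) : 0 <= u <= 1 -> 0 <= v <= 1 ->
  exists2 G : R -> R, {in `](-1), 2[%classic, continuous G} &
  forall s t, 0 <= s -> 0 <= t -> 0 < Num.max s t ->
    psi s t u v = G (Num.min s t / Num.max s t).
Proof.
move=> u01 /andP[v0 v1]; have /andP[u0 u1] := u01.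
have [v0'|v0'] := eqVneq v 0.
  exists (cst 0); first by move=> r _; exact: cvg_cst.
  move=> s t s0 t0 M0; rewrite /psi v0'; case: ifPn => [d0|]; last first.
    by case: ifPn => _ _; rewrite ?mulr0// min_r.
  have E : {in `]0, u[%classic, (fun w => Phi (((Num.sqrt (Num.max t s))%:E * Phi_inv 0
            - (Num.sqrt (Num.min s t))%:E * Phi_inv w)
           * ((Num.sqrt `|t - s|)^-1)%:E)%E) =1 cst 0}.
    move=> w; rewrite inE/= in_itv/= => /andP[w0 wu].
    rewrite (@Phi_invE _ w) ?w0 ?(lt_le_trans wu)// /Phi_inv eqxx.
    rewrite gt0_muleNy ?lte_fin ?sqrtr_gt0 1?maxC//= gt0_mulNye//.
    by rewrite lte_fin invr_gt0 sqrtr_gt0.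
  rewrite Rintegral_itv_cc_oo.
    transitivity (\int[mu]_(w in `]0%R, u[) cst 0 w)%R; first exact: eq_Rintegral.
    by rewrite Rintegral_cst// mul0r.
  by apply: (eq_measurable_fun (cst (0 : R))) => [w wu|]; [rewrite E|exact: measurable_cst].
have [v1'|v1'] := eqVneq v 1.
  exists (cst u); first by move=> r _; exact: cvg_cst.
  move=> s t s0 t0 M0; rewrite /psi v1'; case: ifPn => [d0|]; last first.
    by case: ifPn => _ _; rewrite ?mulr1// min_l.
  have E : {in `]0, u[%classic, (fun w => Phi (((Num.sqrt (Num.max t s))%:E * Phi_inv 1
            - (Num.sqrt (Num.min s t))%:E * Phi_inv w)
           * ((Num.sqrt `|t - s|)^-1)%:E)%E) =1 cst 1}.
    move=> w; rewrite inE/= in_itv/= => /andP[w0 wu].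
    rewrite (@Phi_invE _ w) ?w0 ?(lt_le_trans wu)// /Phi_inv oner_eq0 eqxx.
    rewrite gt0_muley ?lte_fin ?sqrtr_gt0 1?maxC//= gt0_mulye//.
    by rewrite lte_fin invr_gt0 sqrtr_gt0.
  rewrite Rintegral_itv_cc_oo.
    transitivity (\int[mu]_(w in `]0%R, u[) cst 1 w)%R; first exact: eq_Rintegral.
    rewrite Rintegral_cst// mul1r /= lebesgue_measure_itv/= lte_fin.
    by case: ifPn; rewrite ?oppr0 ?addr0//= -leNgt => h; apply/le_anti; rewrite u0 h.
  by apply: (eq_measurable_fun (cst (1 : R))) => [w wu|]; [rewrite E|exact: measurable_cst].
have v01 : 0 < v < 1 by rewrite !lt_neqAle eq_sym v0' v0 v1' v1.
exists (copula_ratio u v); first exact: continuous_copula_ratio.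
by move=> s t s0 t0 M0; apply: psi_ratio_aux.
Qed.

End psi_theory.

(** * Uniform continuity and measurability of psi *)

Section psi_regularity.
Context {R : realType}.

(** Compactness of the segment, in its near-covering form. *)
Lemma heine (f : R -> R) (a b : R) : {within `[a, b], continuous f} ->
  forall e, 0 < e -> exists2 d, 0 < d & forall x y, x \in `[a, b] ->
    y \in `[a, b] -> `|x - y| <= d -> `|f x - f y| <= e.
Proof.
move=> /subspace_continuousP cf e e0.
have := @segment_compact R a b.
move=> /compact_near_coveringP/near_covering_withinP/(_ R (0^'+)
  (fun d x => forall y, y \in `[a, b] -> `|x - y| <= d -> `|f x - f y| <= e) _).
have H0 : forall x, `[a, b]%classic x -> \forall x' \near x & d \near 0^'+,
   `[a, b]%classic x' -> forall y, y \in `[a, b] -> `|x' - y| <= d -> `|f x' - f y| <= e.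
  move=> x xab.
  have e20 : 0 < e / 2 by rewrite divr_gt0.
  have /cvgrPdist_le/(_ _ e20) := cf x xab.
  rewrite /prop_near1 /within /= => -[r /= r0 Hr].
  have r20 : 0 < r / 2 by rewrite divr_gt0.
  exists (ball x (r / 2), [set d | d < r / 2]).
    split; first exact: nbhsx_ballx.
    exact: nbhs_right_lt.
  move=> [x' d] /= [xx' dr] x'ab y yab xy.
  have h1 := Hr x' (ltac:(rewrite /ball_/= (lt_trans xx')// ltr_pdivrMr// ltr_pMr// ltr1n)) x'ab.
  have h2 : `|f x - f y| <= e / 2.
    apply: Hr => //.
    rewrite /ball_/= (splitr r) -(subrKA x') (le_lt_trans (ler_normD _ _))//.
    by rewrite ltrD// (le_lt_trans xy).
  rewrite -(subrKA (f x)) (splitr e) (le_trans (ler_normD _ _))//.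
  by apply: lerD; [rewrite distrC; exact: h1|exact: h2].
move=> /(_ H0) [d /= d0 Hd].
have d20 : 0 < d / 2 by rewrite divr_gt0.
exists (d / 2) => // x y xab yab xy.
apply: (Hd (d / 2)) => //=.
by rewrite sub0r normrN gtr0_norm// ltr_pdivrMr// ltr_pMr// ltr1n.
Qed.

(** Clipping the ratio to [0, 1] turns the function of [psi_ratio] into one
    that is continuous everywhere; pairs of vanishing clocks get u * v. *)
Lemma psi_continuous_ratio (u v : R) : 0 <= u <= 1 -> 0 <= v <= 1 ->
  exists2 G : R -> R, continuous G &
  forall s t, 0 <= s -> 0 <= t ->
    psi s t u v = if 0 < Num.max s t then G (Num.min s t / Num.max s t) else u * v.
Proof.
move=> u01 v01; have [G cG HG] := psi_ratio u01 v01.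
pose clip (r : R) := Num.max 0 (Num.min r 1).
have clip01 r : 0 <= clip r <= 1 by rewrite /clip le_max lexx ge_max ler01 ge_min lexx orbT.
have cclip : continuous clip.
  move=> x; have := (@continuous_max R R (cst 0) ((id : R -> R) \min cst 1) x).
  apply; first exact: cvg_cst.
  by apply: (@continuous_min R R id (cst 1)); [exact: cvg_id|exact: cvg_cst].
exists (G \o clip).
  move=> x; apply: (cvg_comp _ _ (cclip x)).
    apply: cG; rewrite inE /= in_itv/=; have /andP[c0 c1] := clip01 x.
    rewrite (lt_le_trans _ c0) ?ltrN10// (le_lt_trans c1)// ltr1n//.
move=> s t s0 t0; case: ifPn => [M0|].
  rewrite HG//=; congr G; rewrite /clip.
  have q0 : 0 <= Num.min s t / Num.max s t by rewrite divr_ge0 ?le_min ?s0// ltW.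
  have q1 : Num.min s t / Num.max s t <= 1.
    by rewrite ler_pdivrMr// mul1r ge_min !le_max lexx.
  by rewrite (min_l q1) (max_r q0).
rewrite -leNgt ge_max => /andP[s0' t0'].
have -> : s = 0 by apply/le_anti; rewrite s0 s0'.
have -> : t = 0 by apply/le_anti; rewrite t0 t0'.
by rewrite /psi subrr normr0 ltxx andbF.
Qed.

Lemma minr_lipschitz (a b a' b' d : R) : `|a - a'| <= d -> `|b - b'| <= d ->
  `|Num.min a b - Num.min a' b'| <= d.
Proof. by rewrite !ler_distl => /andP[? ?] /andP[? ?]; case: (leP a b); case: (leP a' b'); lra. Qed.

Lemma maxr_lipschitz (a b a' b' d : R) : `|a - a'| <= d -> `|b - b'| <= d ->
  `|Num.max a b - Num.max a' b'| <= d.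
Proof. by rewrite !ler_distl => /andP[? ?] /andP[? ?]; case: (leP a b); case: (leP a' b'); lra. Qed.

(** Once the larger clock is bounded below by al, the ratio of the clocks is a
    Lipschitz function of the pair, with constant 2 / al; then [heine] applies
    to the function of the ratio. *)
Lemma psi_uniformly_continuous (u v al e : R) : 0 <= u <= 1 -> 0 <= v <= 1 ->
  0 < al -> 0 < e -> exists2 d, 0 < d &
  forall a b a' b', 0 <= a -> 0 <= b -> 0 <= a' -> 0 <= b' -> al <= Num.max a b ->
    `|a - a'| <= d -> `|b - b'| <= d -> `|psi a b u v - psi a' b' u v| <= e.
Proof.
move=> u01 v01 al0 e0; have [G cG HG] := psi_continuous_ratio u01 v01.
have [d d0 Hd] := heine (@continuous_subspaceT _ _ `[0 : R, 1]%classic _ cG) e0.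
(* The bound al / 2 keeps the larger perturbed clock positive. *)
exists (Num.min (d * al / 2) (al / 2)).
  by rewrite lt_min !divr_gt0// mulr_gt0.
move=> a b a' b' a0 b0 a'0 b'0 alM aa' bb'.
have M0 : 0 < Num.max a b := lt_le_trans al0 alM.
have mm := minr_lipschitz aa' bb'; have := maxr_lipschitz aa' bb'.
set delta := Num.min (d * al / 2) (al / 2) in mm *.
have M'M : 0 <= Num.min a' b' <= Num.max a' b'.
  by rewrite le_min a'0 b'0/= ge_min !le_max lexx.
have mM : 0 <= Num.min a b <= Num.max a b.
  by rewrite le_min a0 b0/= ge_min !le_max lexx.
move=> MM.
have M'0 : 0 < Num.max a' b'.
  have : delta <= al / 2 by rewrite ge_min lexx orbT.
  by move: MM; rewrite ler_distl => /andP[]; lra.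
rewrite !HG// M0 M'0.
move: M0 M'0 M'M mM MM mm alM.
move: (Num.max a b) (Num.max a' b') (Num.min a b) (Num.min a' b') => M M' m m'.
move=> M0 M'0 /andP[m'0 m'M'] /andP[m0 mM] MM mm alM.
apply: Hd.
- by rewrite in_itv/= divr_ge0 ?(ltW M0)//= ler_pdivrMr// mul1r.
- by rewrite in_itv/= divr_ge0 ?(ltW M'0)//= ler_pdivrMr// mul1r.
have -> : m / M - m' / M' = ((m - m') + (m' / M') * (M' - M)) / M.
  by field; rewrite !gt_eqF.
rewrite normrM normfV (gtr0_norm M0) ler_pdivrMr//.
have q1 : 0 <= m' / M' <= 1.
  by rewrite divr_ge0 ?(ltW M'0)//= ler_pdivrMr// mul1r.
case/andP: q1 => q0 q1.
apply: (@le_trans _ _ (delta + delta)).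
  rewrite (le_trans (ler_normD _ _))// lerD// normrM (ger0_norm q0) distrC.
  by rewrite -[leRHS]mul1r ler_pM.
have : delta <= d * al / 2 by rewrite ge_min lexx.
have : d * al <= d * M by rewrite ler_pM2l.
lra.
Qed.

Lemma measurable_inv : measurable_fun setT (@GRing.inv R).
Proof.
rewrite -(setvU [set (0 : R)]); apply/measurable_funU => //.
  exact: measurableC.
split; last exact: measurable_fun_set1.
apply: open_continuous_measurable_fun; first by apply: closed_openC; exact: closed_eq.
by move=> x; rewrite inE /= => /eqP x0; exact: inv_continuous.
Qed.

Lemma measurable_psi (u v : R) (d : measure_display) (Om : measurableType d)
    (f g : Om -> R) : 0 <= u <= 1 -> 0 <= v <= 1 ->
  measurable_fun setT f -> measurable_fun setT g ->
  (forall w, 0 <= f w) -> (forall w, 0 <= g w) ->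
  measurable_fun setT (fun w => psi (f w) (g w) u v).
Proof.
move=> u01 v01 mf mg f0 g0; have [G cG HG] := psi_continuous_ratio u01 v01.
apply: (eq_measurable_fun (fun w => if 0 < Num.max (f w) (g w) then
   G (Num.min (f w) (g w) / Num.max (f w) (g w)) else u * v)).
  by move=> w _; rewrite HG.
have mM : measurable_fun setT (fun w => Num.max (f w) (g w)) by exact: measurable_maxr.
have mm : measurable_fun setT (fun w => Num.min (f w) (g w)) by exact: measurable_minr.
apply: measurable_fun_ifT => //.
- exact: measurable_fun_ltr.
- apply: (measurableT_comp (f := G)); first exact: continuous_measurable_fun.
  apply: measurable_funM => //.
  by apply: (measurableT_comp (f := @GRing.inv R)); [exact: measurable_inv|].
Qed.

End psi_regularity.

(** * Moments of the centred normal law *)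

Section moments.
Context {R : realType}.
Notation mu := (@lebesgue_measure R).

(** The density represents the measure, so it agrees almost everywhere with
    the Radon-Nikodym derivative, for which the change of variables is known. *)
Lemma ge0_integral_normal_prob (m s : R) (f : R -> \bar R) :
  (forall x, (0 <= f x)%E) -> measurable_fun setT f ->
  (\int[normal_prob m s]_x f x = \int[mu]_x (f x * (normal_pdf m s x)%:E))%E.
Proof.
move=> f0 mf.
pose nu : {finite_measure set _ -> \bar R} := normal_prob m s.
have numu : nu `<< mu by exact: normal_prob_dominates.
have := @Radon_Nikodym_SigmaFinite.change_of_variables _ _ R nu mu numu f setT f0 measurableT mf.
move=> <-.
have mpdf : measurable_fun setT (fun x => (normal_pdf m s x)%:E).
  by apply/measurable_EFinP; exact: measurable_normal_pdf.
have iRN := Radon_Nikodym_SigmaFinite.f_integrable numu.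
apply: ae_eq_integral => //.
- by apply: emeasurable_funM => //; exact: measurable_int iRN.
- by apply: emeasurable_funM.
apply: ae_eqe_mul2l.
apply: integral_ae_eq => //.
move=> E _ mE.
by rewrite -Radon_Nikodym_SigmaFinite.f_integral.
Qed.

(** The fundamental theorem of calculus on [-n, n], then dominated
    convergence. *)
Lemma integral_derive_vanish (f F : R -> R) :
  mu.-integrable setT (EFin \o f) -> continuous f ->
  (forall x : R, is_derive x (1 : R) F (f x)) ->
  F x @[x --> +oo] --> 0 -> F x @[x --> -oo] --> 0 ->
  (\int[mu]_x (f x)%:E = 0)%E.
Proof.
move=> intf cf dF Fy FNy.
have mf : measurable_fun setT (EFin \o f) by exact: measurable_int intf.
pose I (n : nat) : set R := `[- n.+1%:R, n.+1%:R]%classic.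
have IE n : (\int[mu]_x ((EFin \o f) \_ (I n)) x = (F n.+1%:R - F (- n.+1%:R))%:E)%E.
  rewrite -integral_mkcond.
  have cF : continuous F.
    by move=> x; apply: differentiable_continuous; apply/derivable1_diffP.
  rewrite (@continuous_FTC2 _ f F) //.
  - by rewrite -subr_gt0 opprK addr_gt0.
  - by apply: continuous_subspaceT.
  - split; first by [].
    + by apply: cvg_at_right_filter; exact: cF.
    + by apply: cvg_at_left_filter; exact: cF.
  - by move=> x _; rewrite derive1E; exact: derive_val.
have nn : (n.+1%:R : R) @[n --> \oo] --> +oo.
  by rewrite (cvg_shiftS (fun n => n%:R : R)); exact: cvgr_idn.
have H0 : (\int[mu]_x ((EFin \o f) \_ (I n)) x)%E @[n --> \oo] --> 0%E.
  under eq_fun do rewrite IE.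
  apply: cvg_EFin; first exact: nearW.
  rewrite -[X in _ --> X]subr0; apply: cvgB.
    by apply: (cvg_comp (fun n : nat => n.+1%:R) F); last exact: Fy.
  apply: (cvg_comp (fun n : nat => - n.+1%:R) F); last exact: FNy.
  by apply/cvgNrNy.
have [||||_ _ H1] := @dominated_convergence _ _ R mu setT measurableT
  (fun n => (EFin \o f) \_ (I n)) (EFin \o f) (abse \o (EFin \o f)) _ mf.
- move=> n; apply/(measurable_restrictT _ _).1; first by rewrite /I.
  exact: measurable_funTS.
- apply/aeW => x _.
  apply: cvg_near_cst.
  near=> n.
  rewrite patchE mem_set // /I /= in_itv /= -ler_norml.
  by near: n; apply: (cvgry_ge nn).
- exact: integrable_abse.
- apply/aeW => x n _; rewrite patchE; case: ifPn => //= _.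
  by rewrite normr0 lee_fin.
- by move/cvg_lim : H1 => <- //; apply/cvg_lim.
Unshelve. all: end_near. Qed.

Section normal.
Variable s : R.
Hypothesis s0 : 0 < s.
Notation p := (normal_pdf 0 s).

Let sN0 : s != 0. Proof. by rewrite gt_eqF. Qed.

(** A Gaussian of standard deviation 2 s decays more slowly than one of
    standard deviation s times any power; this gives both the integrability of
    z ^+ k * p z and its decay at infinity. *)
Lemma normal_pdf_pow_le (k : nat) :
  exists2 K : R, 0 <= K & forall z, `|z ^+ k * p z| <= K * normal_pdf 0 (2 * s) z.
Proof.
(* The exponents of the two densities differ by z ^+ 2 / c. *)
pose c := 8 * s ^+ 2 / 3.
have c0 : 0 < c by rewrite /c divr_gt0// mulr_gt0// exprn_gt0.
pose C := 1 + c ^+ k.+1 * (k.+1)`!%:R.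
have C0 : 0 <= C by rewrite addr_ge0// mulr_ge0// exprn_ge0// ltW.
have s20 : 2 * s != 0 by rewrite mulf_neq0.
have pk := normal_peak_gt0 s20.
exists (C * (normal_peak s / normal_peak (2 * s))).
  by rewrite mulr_ge0// divr_ge0// normal_peak_ge0.
move=> z; rewrite !normal_pdfE// normrM (ger0_norm (mulr_ge0 _ _)) ?normal_peak_ge0 ?normal_fun_ge0//.
rewrite /normal_fun subr0.
have -> : `|z ^+ k| * (normal_peak s * expR (- z ^+ 2 / (s ^+ 2 *+ 2))) =
  (`|z| ^+ k * expR (- z ^+ 2 / (s ^+ 2 *+ 2))) * normal_peak s.
  by rewrite normrX; ring.
have -> : C * (normal_peak s / normal_peak (2 * s)) *
   (normal_peak (2 * s) * expR (- z ^+ 2 / ((2 * s) ^+ 2 *+ 2))) =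
   (C * expR (- z ^+ 2 / ((2 * s) ^+ 2 *+ 2))) * normal_peak s.
  by field; rewrite gt_eqF.
apply: ler_wpM2r; first exact: normal_peak_ge0.
pose y := z ^+ 2 / c.
have y0 : 0 <= y by rewrite divr_ge0 ?sqr_ge0// ltW.
have -> : - z ^+ 2 / ((2 * s) ^+ 2 *+ 2) = - z ^+ 2 / (s ^+ 2 *+ 2) + y.
  by rewrite /y /c; field.
rewrite expRD mulrCA mulrC.
apply: ler_wpM2l; first exact: expR_ge0.
have zk : `|z| ^+ k <= 1 + (z ^+ 2) ^+ k.+1.
  rewrite -(real_normK (num_real z)) -exprM.
  have [z1|z1] := leP `|z| 1.
    by rewrite (@le_trans _ _ 1) ?exprn_ile1// lerDl exprn_ge0.
  rewrite (@le_trans _ _ (`|z| ^+ (2 * k.+1))) ?lerDr//.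
  by rewrite ler_eXn2l// mulnS mul2n -addnn; lia.
rewrite (le_trans zk)// /C mulrDl mul1r lerD//.
  by rewrite -expR0 ler_expR.
have zcy : z ^+ 2 = c * y by rewrite /y mulrC divfK// gt_eqF.
have fk : (k.+1)`!%:R != 0 :> R by rewrite pnatr_eq0 -lt0n fact_gt0.
rewrite zcy exprMn -mulrA; apply: ler_wpM2l; first by rewrite exprn_ge0// ltW.
rewrite -[leLHS](mulfVK fk) mulrC ler_wpM2l//.
apply: le_trans (expR_ge1Dxn k y0).
by rewrite lerDr.
Qed.

Lemma integrable_normal_pdf_pow (k : nat) :
  mu.-integrable setT (EFin \o (fun z => z ^+ k * p z)).
Proof.
have [K K0 HK] := normal_pdf_pow_le k.
apply: (@le_integrable _ _ _ mu setT measurableT _ (EFin \o (fun z => K * normal_pdf 0 (2 * s) z))).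
- apply/measurable_EFinP; apply: measurable_funM; last exact: measurable_normal_pdf.
  exact: measurable_funX.
- move=> z _ /=; rewrite lee_fin (le_trans (HK z))//.
  by rewrite ler_norm.
- have := integrableZl measurableT K (integrable_normal_pdf 0 (2 * s)).
  by apply: eq_integrable.
Qed.

Lemma cvg_normal_pdf_pow_pinfty (k : nat) : z ^+ k * p z @[z --> +oo] --> 0.
Proof.
have [K K0 HK] := normal_pdf_pow_le k.+1.
have s20 : 2 * s != 0 by rewrite mulf_neq0.
pose C := K * normal_peak (2 * s).
have HC z : `|z| * `|z ^+ k * p z| <= C.
  rewrite -normrM mulrA -exprS (le_trans (HK z))// ler_wpM2l//.
  exact: normal_pdf_ub.
apply/cvgrPdist_le => e e0; near=> z.
have z0 : 0 < z by near: z; exact: nbhs_pinfty_gt.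
have zC : C / e <= z by near: z; apply: nbhs_pinfty_ge; exact: num_real.
rewrite sub0r normrN -(ler_pM2l z0) -{1}(gtr0_norm z0) (le_trans (HC z))//.
by rewrite -ler_pdivrMr.
Unshelve. all: end_near. Qed.

Lemma cvg_normal_pdf_pow_ninfty (k : nat) : z ^+ k * p z @[z --> -oo] --> 0.
Proof.
have [K K0 HK] := normal_pdf_pow_le k.+1.
have s20 : 2 * s != 0 by rewrite mulf_neq0.
pose C := K * normal_peak (2 * s).
have HC z : `|z| * `|z ^+ k * p z| <= C.
  rewrite -normrM mulrA -exprS (le_trans (HK z))// ler_wpM2l//.
  exact: normal_pdf_ub.
apply/cvgrPdist_le => e e0; near=> z.
have z0 : z < 0 by near: z; exact: nbhs_ninfty_lt.
have zC : z <= - (C / e) by near: z; apply: nbhs_ninfty_le; exact: num_real.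
have nz0 : 0 < - z by rewrite oppr_gt0.
rewrite sub0r normrN -(ler_pM2l nz0) -{1}(ltr0_norm z0) (le_trans (HC z))//.
by rewrite -ler_pdivrMr// lerNr.
Unshelve. all: end_near. Qed.

Lemma is_derive_normal_pdf (x : R) : is_derive x (1 : R) p (- x / s ^+ 2 * p x).
Proof.
rewrite normal_pdfE//.
have nE z : normal_fun 0 s z = expR (- (s ^+ 2 *+ 2)^-1 * z ^+ 2).
  by rewrite /normal_fun subr0 !mulNr mulrC.
under eq_fun do rewrite nE.
apply: is_derive_eq.
rewrite /GRing.scale /= nE; move: (expR _) => e.
by field.
Qed.

Let m (k : nat) := (\int[mu]_z (z ^+ k * p z))%R.

(** Integration by parts: the derivative of z ^+ k.+1 * p z is
    k.+1%:R * (z ^+ k * p z) - s ^- 2 * (z ^+ k.+2 * p z). *)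
Lemma normal_moment_rec (k : nat) : m k.+2 = s ^+ 2 * k.+1%:R * m k.
Proof.
pose f z := k.+1%:R * (z ^+ k * p z) - (s ^+ 2)^-1 * (z ^+ k.+2 * p z).
have i1 j c : mu.-integrable setT (EFin \o (fun z => c * (z ^+ j * p z))).
  have := integrableZl measurableT c (integrable_normal_pdf_pow j).
  by apply: eq_integrable.
have intf : mu.-integrable setT (EFin \o f).
  have := integrableB measurableT (i1 k k.+1%:R) (i1 k.+2 (s ^+ 2)^-1).
  by apply: eq_integrable.
have H : (\int[mu]_x (f x) = 0)%R.
  have cf : continuous f.
    move=> x; apply: cvgB; apply: cvgM; (try exact: cvg_cst); apply: cvgM;
      by [exact: exprn_continuous|exact: continuous_normal_pdf].
  have dF (x : R) : is_derive x (1 : R) (fun z => z ^+ k.+1 * p z) (f x).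
    have dX : is_derive x (1 : R) ((id : R -> R) ^+ k.+1) (k.+1%:R * x ^+ k).
      by apply: is_derive_eq; rewrite /GRing.scale /= mulr1.
    have -> : (fun z => z ^+ k.+1 * p z) = (id : R -> R) ^+ k.+1 * p.
      by apply/funext => z; rewrite /= exprfctE.
    apply: is_derive_eq (is_deriveM dX (is_derive_normal_pdf x)) _.
    rewrite /GRing.scale /= /f exprfctE !exprS.
    by field.
  rewrite /Rintegral (integral_derive_vanish intf cf dF)//.
  - exact: cvg_normal_pdf_pow_pinfty.
  - exact: cvg_normal_pdf_pow_ninfty.
move: H; rewrite RintegralB// !RintegralZl//; last 2 first.
- exact: integrable_normal_pdf_pow.
- exact: integrable_normal_pdf_pow.
rewrite -/(m k) -/(m k.+2) => /eqP; rewrite subr_eq0 => /eqP H.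
rewrite -mulrA H mulrA mulfV ?mul1r//.
by rewrite expf_neq0.
Qed.

Lemma normal_moment0 : m 0 = 1.
Proof.
rewrite /m; under eq_Rintegral do rewrite expr0 mul1r.
by rewrite /Rintegral integral_normal_pdf.
Qed.

(** When x is the value of an independent past, this says that the centred
    square z ^+ 2 - s ^+ 2 adds its variance 2 * s ^+ 4 to the second moment:
    the cross term vanishes. *)
Lemma integral_normal_prob_centered_square (x : R) :
  (\int[normal_prob 0%R s]_z ((x + (z ^+ 2 - s ^+ 2)) ^+ 2)%:E = (x ^+ 2 + 2 * s ^+ 4)%:E)%E.
Proof.
have m2 : m 2 = s ^+ 2 by rewrite normal_moment_rec normal_moment0 !mulr1.
have m4 : m 4 = 3 * s ^+ 4 by rewrite normal_moment_rec m2; ring.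
rewrite ge0_integral_normal_prob; last 2 first.
- by move=> z; rewrite lee_fin sqr_ge0.
- apply/measurable_EFinP; apply: measurable_funX; apply: measurable_funD => //.
  by apply: measurable_funB => //; exact: measurable_funX.
have i1 j c : mu.-integrable setT (EFin \o (fun z => c * (z ^+ j * p z))).
  have := integrableZl measurableT c (integrable_normal_pdf_pow j).
  by apply: eq_integrable.
pose a := x - s ^+ 2.
pose f z := (a ^+ 2 * (z ^+ 0 * p z) + (2 * a) * (z ^+ 2 * p z)) + 1 * (z ^+ 4 * p z).
have i12 : mu.-integrable setT (EFin \o (fun z => a ^+ 2 * (z ^+ 0 * p z) + (2 * a) * (z ^+ 2 * p z))).
  have := integrableD measurableT (i1 0%N (a ^+ 2)) (i1 2%N (2 * a)).
  by apply: eq_integrable.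
have intf : mu.-integrable setT (EFin \o f).
  have := integrableD measurableT i12 (i1 4 1).
  by apply: eq_integrable.
transitivity (\int[mu]_z (f z)%:E)%E.
  apply: eq_integral => z _; rewrite -EFinM /f /a; congr (_%:E); ring.
rewrite -[LHS]fineK; last exact: integrable_fin_num intf.
congr (_%:E).
transitivity (\int[mu]_z f z)%R; first by [].
have Z c j : (\int[mu]_z (c * (z ^+ j * p z)) = c * m j)%R.
  by rewrite RintegralZl//; exact: integrable_normal_pdf_pow.
rewrite RintegralD// RintegralD// !Z normal_moment0 m2 m4 /a; ring.
Qed.

End normal.
End moments.

(** * Null limits, independence and squared Brownian increments *)

Section probability_tools.
Context d {Om : measurableType d} {R : realType} (P : probability Om R).

(** The limsup of the events is contained in the null set N, and its
    probability bounds the limit. *)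
Lemma eventually_notin_cvg0 (A : (set Om)^nat) (N : set Om) :
  (forall n, measurable (A n)) -> measurable N -> P N = 0%E ->
  (forall w, ~ N w -> \forall n \near \oo, ~ A n w) ->
  P (A n) @[n --> \oo] --> 0%E.
Proof.
move=> mA mN N0 HA.
have mU n : measurable (\bigcup_(k >= n) A k) by apply: bigcup_measurable.
have lim0 : P (lim_sup_set A) = 0%E.
  apply: (@subset_measure0 _ _ _ P _ N) => //.
    by apply: bigcapT_measurable => n; exact: mU.
  move=> w Aw; apply: contrapT => /HA [k _ Hk].
  by have [j /= kj Aj] := Aw k I; exact: (Hk j).
have := @lim_sup_set_cvg _ _ _ P A mA; rewrite /= lim0 => H.
apply: (@squeeze_cvge _ _ _ _ (fun=> 0%E) _ (fun n => P (\bigcup_(k >= n) A k))).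
- apply: nearW => n; rewrite measure_ge0/= le_measure ?inE//.
  by move=> w Aw; exists n => //=.
- exact: cvg_cst.
- by apply: H; rewrite (le_lt_trans (probability_le1 _ _))// ltry.
Qed.

(** The law of (S, D) is the product of the law of S and nu, because they agree
    on rectangles; then Tonelli's theorem applies. *)
Lemma independent_integral d2 (E : measurableType d2) (G : set (set Om))
    (S : Om -> R) (D : Om -> E) (nu : probability E R) (f : R * E -> \bar R) :
  measurable_fun setT S -> measurable_fun setT D ->
  (forall A, measurable A -> G (S @^-1` A)) ->
  independent P G (preimage_set_system setT D measurable) ->
  (forall A, measurable A -> P (D @^-1` A) = nu A) ->
  measurable_fun setT f -> (forall x, (0 <= f x)%E) ->
  (\int[P]_w f (S w, D w) = \int[P]_w \int[nu]_z f (S w, z))%E.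
Proof.
move=> mS mD GS ind Dnu mf f0.
have mh : measurable_fun setT (fun w => (S w, D w)) by exact: measurable_fun_pair.
pose h : {mfun Om >-> (R * E)%type} := mfun_Sub (mem_set mh).
pose S' : {mfun Om >-> R} := mfun_Sub (mem_set mS).
have H A : measurable A -> (distribution P S' \x nu)%E A = distribution P h A.
  apply: product_measure_unique => {}A B mA mB.
  change (P ((S @^-1` A) `&` (D @^-1` B)) = P (S @^-1` A) * nu B)%E.
  rewrite ind//; first by rewrite Dnu.
    exact: GS.
  by exists B => //; rewrite setTI.
have <- : (\int[distribution P h]_x f x = \int[P]_w f (S w, D w))%E.
  by rewrite ge0_integral_distribution.
have <- : (\int[(distribution P S' \x nu)%E]_x f x = \int[distribution P h]_x f x)%E.
  by apply: eq_measure_integral => A mA _; exact: H.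
rewrite fubini_tonelli1// ge0_integral_distribution//.
  exact: measurable_fun_fubini_tonelli_F.
by move=> x; apply: integral_ge0.
Qed.

Lemma chebyshev_second_moment (S : Om -> R) (eta : R) : 0 < eta ->
  measurable_fun setT S ->
  (P [set w | (eta <= `|S w|)%R] <= (eta ^- 2)%:E * \int[P]_w ((S w) ^+ 2)%:E)%E.
Proof.
move=> eta0 mS.
pose S' : {mfun Om >-> R} := mfun_Sub (mem_set mS).
have := @markov _ _ _ P S' (fun x => x ^+ 2) eta eta0.
move=> /(_ (measurable_funX _ (@measurable_id _ _ setT))).
case/(_ _ _)/Wrap => [r _|x y x0 y0 xy|]; first exact: sqr_ge0.
  by rewrite ler_sqr.
rewrite unlock /=.
have -> : [set x | (eta%:E <= `|S x|%:E)%E] = [set w | (eta <= `|S w|)%R].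
  by apply/seteqP; split => w /=; rewrite lee_fin.
have -> : (\int[P]_w (((fun x => x ^+ 2) \o Num.norm \o S) w)%:E = \int[P]_w ((S w) ^+ 2)%:E)%E.
  by apply: eq_integral => w _ /=; rewrite real_normK// num_real.
move=> H.
rewrite -(@lee_pmul2l _ (eta ^+ 2)%:E)//; last by rewrite lte_fin exprn_gt0.
rewrite muleA -EFinM mulfV ?mul1e// expf_neq0// gt_eqF//.
Qed.

End probability_tools.

Section brownian_variance.
Context d {Om : measurableType d} {R : realType} (P : probability Om R).
Variable W : R -> Om -> R.
Hypothesis W_BM : standard_brownian_motion P W.

Let mW t : 0 <= t -> measurable_fun setT (W t).
Proof. by case: W_BM => + _ _ _ _; apply. Qed.

(** Centred when W is a Brownian motion, the variance of W t - W s being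
    t - s. *)
Definition centered_increment (s t : R) (w : Om) : R := (W t w - W s w) ^+ 2 - (t - s).

Lemma sigma_process_measurable d' (E : measurableType d') (J : set R) (Y : R -> Om -> E) t :
  J t -> measurable_fun (T := g_sigma_algebraType (\bigcup_(i in J)
     preimage_set_system setT (Y i) measurable)) setT (Y t).
Proof.
move=> Jt _ A mA; apply: sub_sigma_algebra; exists t => //.
by exists A.
Qed.

Lemma sigma_process_sum (tau : nat -> R) (m : nat) :
  (forall i, (i <= m)%N -> 0 <= tau i <= tau m) ->
  measurable_fun (T := g_sigma_algebraType (\bigcup_(i in `[0, tau m])
     preimage_set_system setT (W i) measurable)) setT
  (fun w => \sum_(i < m) centered_increment (tau i) (tau i.+1) w).
Proof.
move=> Htau; apply: measurable_sum => i.
apply: measurable_funB => //; apply: measurable_funX.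
by apply: measurable_funB; apply: sigma_process_measurable;
  rewrite /= in_itv/= Htau// ltnW.
Qed.

(** Orthogonality of martingale differences, one step at a time: the last
    increment is independent of the past, on which the sum of the previous terms
    depends, so [integral_normal_prob_centered_square] adds its variance. *)
Lemma second_moment_centered_sum (tau : nat -> R) (m : nat) :
  0 <= tau 0%N -> nondecreasing_seq tau ->
  (\int[P]_w ((\sum_(i < m) centered_increment (tau i) (tau i.+1) w) ^+ 2)%:E
   = (\sum_(i < m) 2 * (tau i.+1 - tau i) ^+ 2)%:E)%E.
Proof.
move=> tau00 nd.
have tau0 i : 0 <= tau i by rewrite (le_trans tau00)// nd.
elim: m => [|m IH].
  rewrite big_ord0; under eq_integral do rewrite big_ord0 expr0n/=.
  by rewrite integral0.
under eq_integral do rewrite big_ord_recr/=.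
rewrite big_ord_recr/= EFinD -IH.
have : tau m <= tau m.+1 by apply: nd.
rewrite le_eqVlt => /orP[/eqP tt|tt].
  (* An empty time step contributes a zero summand. *)
  rewrite -tt subrr expr0n/= mulr0 adde0.
  by apply: eq_integral => w _; rewrite /centered_increment !subrr expr0n/= subr0 addr0.
pose D w := W (tau m.+1) w - W (tau m) w.
pose S w := \sum_(i < m) centered_increment (tau i) (tau i.+1) w.
pose s := Num.sqrt (tau m.+1 - tau m).
have s0 : 0 < s by rewrite sqrtr_gt0 subr_gt0.
have s2 : s ^+ 2 = tau m.+1 - tau m by rewrite sqr_sqrtr// subr_ge0 ltW.
have mD : measurable_fun setT D by apply: measurable_funB; apply: mW.
have mS : measurable_fun setT S.
  apply: measurable_sum => i; apply: measurable_funB => //; apply: measurable_funX.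
  by apply: measurable_funB; apply: mW.
pose f (x : R * R) := ((x.1 + (x.2 ^+ 2 - s ^+ 2)) ^+ 2)%:E.
transitivity (\int[P]_w f (S w, D w))%E.
  by apply: eq_integral => w _; rewrite /f /= s2.
case: W_BM => _ _ ind law _.
have mf : measurable_fun setT f.
  apply/measurable_EFinP; apply: measurable_funX; apply: measurable_funD => //.
  by apply: measurable_funB => //; apply: measurable_funX.
have f0 x : (0 <= f x)%E by rewrite lee_fin sqr_ge0.
have SG A : measurable A -> sigma_process `[0, tau m] W (S @^-1` A).
  move=> mA.
  have := @sigma_process_sum tau m _ measurableT A mA.
  rewrite setTI; apply => i im; rewrite tau0 nd//.
have Dlaw A : measurable A -> P (D @^-1` A) = normal_prob 0 s A.
  exact: law.
pose nu : probability (measurableTypeR R) R := normal_prob 0 s.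
rewrite (independent_integral (E := measurableTypeR R) (nu := nu) mS mD SG (ind _ _ (tau0 m) tt) Dlaw mf f0).
under eq_integral do rewrite /f /= integral_normal_prob_centered_square//.
have s4 : s ^+ 4 = (tau m.+1 - tau m) ^+ 2 by rewrite -s2 -exprM.
under eq_integral do rewrite EFinD s4.
rewrite ge0_integralD//.
- by rewrite integral_cst//= probability_setT mule1.
- by move=> w _; rewrite lee_fin sqr_ge0.
- by apply/measurable_EFinP; apply: measurable_funX.
- by move=> w _; rewrite lee_fin mulr_ge0// sqr_ge0.
Qed.

(** Chebyshev's inequality; the sum of the squared increments of tau is at most
    the largest increment times tau m. *)
Lemma centered_sum_tail (tau : nat -> R) (m : nat) (eta del : R) :
  0 <= tau 0%N -> nondecreasing_seq tau -> 0 < eta -> 0 <= del ->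
  (forall i, (i < m)%N -> tau i.+1 - tau i <= del) ->
  (P [set w | (eta <= `|\sum_(i < m) centered_increment (tau i) (tau i.+1) w|)%R]
   <= (2 * del * tau m / eta ^+ 2)%:E)%E.
Proof.
move=> tau00 nd eta0 del0 hd.
have tau0 i : 0 <= tau i by rewrite (le_trans tau00)// nd.
have mS : measurable_fun setT (fun w => \sum_(i < m) centered_increment (tau i) (tau i.+1) w).
  apply: measurable_sum => i; apply: measurable_funB => //; apply: measurable_funX.
  by apply: measurable_funB; apply: mW.
apply: le_trans (chebyshev_second_moment P eta0 mS) _.
rewrite second_moment_centered_sum// -EFinM lee_fin mulrC ler_wpM2r//.
  by rewrite invr_ge0 exprn_ge0// ltW.
apply: (@le_trans _ _ (\sum_(i < m) 2 * del * (tau i.+1 - tau i))).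
  apply: ler_sum => i _; rewrite expr2 -mulrA ler_pM2l// ler_wpM2r ?hd//.
  by rewrite subr_ge0 nd.
rewrite -mulr_sumr; apply: ler_wpM2l; first by rewrite mulr_ge0.
rewrite -(big_mkord xpredT (fun i => tau i.+1 - tau i)) telescope_sumr//.
by rewrite gerBl.
Qed.

End brownian_variance.

(** * Rounding of the clock and conditioning on a countable variable *)

Section discretization.
Context {R : realType}.
Implicit Types x y : R.

Definition mesh_index (k : nat) (x : R) : nat := Num.truncn (k.+1%:R * x).
Definition mesh_floor (k : nat) (x : R) : R := (mesh_index k x)%:R / k.+1%:R.

Lemma mesh_floor_ge0 k x : 0 <= mesh_floor k x.
Proof. by rewrite divr_ge0. Qed.

Lemma mesh_floor_itv k x : 0 <= x -> mesh_floor k x <= x < mesh_floor k x + k.+1%:R^-1.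
Proof.
move=> x0.
have /andP[h1 h2] := truncn_itv (mulr_ge0 (ler0n R k.+1) x0).
apply/andP; split; first by rewrite ler_pdivrMr// mulrC.
by rewrite -[X in _ + X]mul1r -mulrDl ltr_pdivlMr// mulrC (lt_le_trans h2)// natr1.
Qed.

Lemma le_mesh_index k x y : x <= y -> (mesh_index k x <= mesh_index k y)%N.
Proof. by move=> xy; apply: le_truncn; rewrite ler_pM2l. Qed.

Lemma le_mesh_floor k x y : x <= y -> mesh_floor k x <= mesh_floor k y.
Proof. by move=> xy; rewrite ler_wpM2r// ler_nat le_mesh_index. Qed.

Lemma mesh_floor_cvg x : 0 <= x -> mesh_floor k x @[k --> \oo] --> x.
Proof.
move=> x0; apply/cvgrPdist_le => e e0; near=> k.
have /andP[h1 h2] := mesh_floor_itv k x0.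
rewrite ger0_norm ?subr_ge0//.
have : k.+1%:R^-1 < e by near: k; exact: (near_infty_natSinv_lt (PosNum e0)).
by move=> ke; rewrite lerBlDl (le_trans (ltW h2))// lerD2l ltW.
Unshelve. all: end_near. Qed.

End discretization.

Section discrete_conditioning.
Context d {Om : measurableType d} {R : realType}.

Lemma measurable_map_eq (J : nat -> Om -> nat) (l : seq nat) :
  (forall i n, measurable [set w | J i w = n]) ->
  forall s, measurable [set w | [seq J i w | i <- l] = s].
Proof.
move=> mJ; elim: l => [|a l IH] [|x s] /=.
- rewrite (_ : [set _ | _] = setT)//.
  by apply/seteqP; split.
- rewrite (_ : [set _ | _] = set0)//.
  by apply/seteqP; split.
- rewrite (_ : [set _ | _] = set0)//.
  by apply/seteqP; split.
- rewrite (_ : [set _ | _] = [set w | J a w = x] `&` [set w | [seq J i w | i <- l] = s]).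
    by apply: measurableI.
  by apply/seteqP; split => w /=; [case=> -> -> | case=> -> ->].
Qed.

(** Conditioning on a countable variable phi: on the atom where phi = n the
    event A (phi w) is A n, which is independent of the atom, so its probability
    is at most c times that of the atom, and the atoms add up to at most 1. *)
Lemma independent_discrete_bound (P : probability Om R) (G H : set (set Om))
    (phi : Om -> nat) (A : nat -> set Om) (B : set Om) (c : R) :
  independent P G H -> (forall n, G (A n)) -> (forall n, measurable (A n)) ->
  (forall n, H (B `&` [set w | phi w = n])) ->
  (forall n, measurable (B `&` [set w | phi w = n])) -> measurable B ->
  0 <= c -> (forall w, B w -> (P (A (phi w)) <= c%:E)%E) ->
  (P [set w | B w /\ A (phi w) w] <= c%:E)%E.
Proof.
move=> ind GA mA HB mB mBB c0 PA.
pose F n := A n `&` (B `&` [set w | phi w = n]).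
have mF n : measurable (F n) by apply: measurableI.
have -> : [set w | B w /\ A (phi w) w] = \bigcup_n F n.
  apply/seteqP; split => w /=; first by move=> [Bw Aw]; exists (phi w).
  by move=> [n _ [/= Aw [Bw pw]]]; rewrite pw.
have tB : trivIset setT (fun n => B `&` [set w | phi w = n]).
  by move=> i j _ _ [w [[_ /= <-] [_ /= <-]]].
have tF : trivIset setT F by exact: trivIset_setIl.
rewrite measure_bigcup//.
have le1 n : (P (F n) <= c%:E * P (B `&` [set w | phi w = n]))%E.
  rewrite /F ind//.
  have [->|/set0P[w [Bw pw]]] := eqVneq (B `&` [set w | phi w = n]) set0.
    by rewrite measure0 !mule0.
  by apply: lee_wpmul2r => //; rewrite -pw; exact: PA.
apply: (@le_trans _ _ (\sum_(i <oo | i \in setT) c%:E * P (B `&` [set w | phi w = i]))%E).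
  by apply: lee_nneseries => // i _; exact: le1.
rewrite nneseriesZl//.
rewrite -measure_bigcup// -[leRHS]mule1.
apply: lee_wpmul2l; first by rewrite lee_fin.
by apply: probability_le1; exact: bigcup_measurable.
Qed.

End discrete_conditioning.

(** * Realized variation of a Brownian motion run by an independent clock *)

Section time_change.
Context d {Om : measurableType d} {R : realType} (P : probability Om R).
(* N is a null set off which the almost sure properties of the paths hold. *)
Variables (W : R -> Om -> R) (T : R -> Om -> \bar R) (N : set Om).
Hypothesis complete : P.-negligible `<=` measurable.
Hypothesis W_BM : standard_brownian_motion P W.
Hypothesis T_ge0 : forall t w, 0 <= t -> (0 <= T t w)%E.
Hypothesis mT : forall t, 0 <= t -> measurable_fun setT (T t).
Hypothesis WT_ind : independent_processes P W T.
Hypothesis mN : measurable N.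
Hypothesis N0 : P N = 0%E.
Hypothesis T_mono : forall w, ~ N w ->
  forall s t, 0 <= s -> s <= t -> (T s w <= T t w)%E.
Hypothesis T_cont : forall w, ~ N w ->
  {within `[0, +oo[, continuous (fun t : R => T t w)}.
Hypothesis T_start : forall w, ~ N w -> T 0 w = 0%E.
Hypothesis T_fin : forall w, ~ N w -> forall t, 0 <= t -> (T t w < +oo)%E.
Hypothesis W_cont : forall w, ~ N w ->
  {within `[0, +oo[, continuous (fun t : R => W t w)}.

Notation th t w := (fine (T t w)).
Notation X := (time_changed W T).

Lemma clock_ge0 t w : 0 <= t -> 0 <= th t w.
Proof. by move=> t0; rewrite fine_ge0// T_ge0. Qed.

Lemma clock_fin_num t w : ~ N w -> 0 <= t -> T t w \is a fin_num.
Proof. by move=> Nw t0; rewrite ge0_fin_numE ?T_fin ?T_ge0. Qed.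

Lemma clock_mono w s t : ~ N w -> 0 <= s -> s <= t -> th s w <= th t w.
Proof.
move=> Nw s0 st; rewrite fine_le ?clock_fin_num ?T_mono//.
exact: le_trans st.
Qed.

Lemma clock_continuous w b : ~ N w ->
  {within `[0, b], continuous (fun t : R => th t w)}.
Proof.
move=> Nw.
have /subspace_continuousP H : {within `[0, b], continuous (fun t : R => T t w)}.
  by apply: continuous_subspaceW (T_cont Nw) => x /=; rewrite !in_itv/= => /andP[->].
apply/subspace_continuousP => x xb.
apply: fine_cvg; rewrite fineK; first exact: H.
by apply: clock_fin_num => //; move: xb; rewrite /= in_itv/= => /andP[].
Qed.

Lemma measurable_clock t : 0 <= t -> measurable_fun setT (fun w => th t w).
Proof. by move=> t0; apply: measurableT_comp => //; exact: mT. Qed.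

(** This is where completeness of P enters: a set that is known only off N is
    still measurable. *)
Lemma null_set_measurable (A B : set Om) : measurable B ->
  (forall w, ~ N w -> A w <-> B w) -> measurable A.
Proof.
move=> mB AB.
have -> : A = (B `\` N) `|` (A `&` N).
  apply/seteqP; split => w.
    by move=> Aw; have [Nw|Nw] := pselect (N w); [right|left; split => //; exact/AB].
  by case=> [[Bw Nw]|[]//]; exact/AB.
apply: measurableU; first exact: measurableD.
by apply: complete; exists N; split => // w [].
Qed.

Lemma null_set_measurable_fun (f g : Om -> R) : measurable_fun setT g ->
  (forall w, ~ N w -> f w = g w) -> measurable_fun setT f.
Proof.
move=> mg fg _ A mA; rewrite setTI.
apply: (@null_set_measurable _ (g @^-1` A)); first by rewrite -[_ @^-1` _]setTI; exact: mg.
by move=> w Nw; rewrite /preimage /= fg.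
Qed.

Lemma measurable_mesh_index d' (Om' : measurableType d') (f : Om' -> R) k n :
  measurable_fun setT f -> (forall w, 0 <= f w) ->
  measurable [set w | mesh_index k (f w) = n].
Proof.
move=> mf f0.
have -> : [set w | mesh_index k (f w) = n] =
   (fun w => k.+1%:R * f w) @^-1` `[n%:R, n.+1%:R[%classic.
  apply/seteqP; split => w /=; rewrite in_itv/= /mesh_index.
    by move/eqP; rewrite truncn_eq// mulr_ge0.
  by rewrite -truncn_eq ?mulr_ge0// => /eqP.
rewrite -[_ @^-1` _]setTI.
have : measurable_fun setT (fun w => k.+1%:R * f w) by apply: measurable_funM.
by apply.
Qed.

Lemma W_path_cvg w x : ~ N w -> 0 <= x ->
  W (mesh_floor k x) w @[k --> \oo] --> W x w.
Proof.
move=> Nw x0; have /subspace_continuousP H := W_cont Nw.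
have xx : `[0, +oo[%classic x by rewrite /= in_itv/= x0.
apply: cvg_trans (H x xx).
move=> A /= [e e0 He].
have /cvgrPdist_lt/(_ e e0) [n _ Hn] := mesh_floor_cvg x0.
exists n => // k nk; apply: He; first exact: Hn.
by rewrite /= in_itv/= mesh_floor_ge0.
Qed.

Lemma measurable_W_mesh k t : 0 <= t ->
  measurable_fun setT (fun w => W (mesh_floor k (th t w)) w).
Proof.
move=> t0 _ A mA; rewrite setTI.
have -> : (fun w => W (mesh_floor k (th t w)) w) @^-1` A =
    \bigcup_j ([set w | mesh_index k (th t w) = j] `&`
      (W (j%:R / k.+1%:R) @^-1` A)).
  apply/seteqP; split => w /=.
    by move=> Aw; exists (mesh_index k (th t w)).
  by move=> [j _ [/= <-]].
apply: bigcup_measurable => j _; apply: measurableI.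
  by apply: measurable_mesh_index; [exact: measurable_clock|move=> w; exact: clock_ge0].
rewrite -[_ @^-1` _]setTI.
case: W_BM => mW _ _ _ _.
exact: (mW _ (divr_ge0 (ler0n _ _) (ler0n _ _)) measurableT A mA).
Qed.

(** W need not be jointly measurable in time and outcome, so X t is obtained as
    the limit, off N, of W evaluated at the rounded clock; the rounded clock
    takes countably many values, and W is measurable at each of them. *)
Lemma measurable_time_changed t : 0 <= t -> measurable_fun setT (X t).
Proof.
move=> t0.
pose Y k w := W (mesh_floor k (th t w)) w.
have mY k : measurable_fun setT (Y k) by exact: measurable_W_mesh.
apply: (@null_set_measurable_fun _ ((X t) \_ (~` N))); last first.
  by move=> w Nw; rewrite patchE mem_set.
apply: (@measurable_fun_cvg _ _ _ _ (fun k => Y k \_ (~` N))).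
  move=> k; apply/(measurable_restrictT _ _).1; first exact: measurableC.
  exact: measurable_funTS.
move=> w _.
have [Nw|Nw] := pselect (N w).
  have NNw : ~ (~` N) w by move=> h; exact: h Nw.
  rewrite patchE memNset//; apply: cvg_near_cst; apply: nearW => k.
  by rewrite patchE memNset.
rewrite patchE mem_set//.
have -> : (fun k => (Y k \_ (~` N)) w) = (fun k => Y k w).
  by apply/funext => k; rewrite patchE mem_set.
by apply: W_path_cvg => //; exact: clock_ge0.
Qed.

Lemma measurable_cst_lt (f : Om -> R) (c : R) : measurable_fun setT f ->
  measurable [set w | c < f w].
Proof.
move=> mf; have -> : [set w | c < f w] = f @^-1` `]c, +oo[%classic.
  by apply/seteqP; split => w /=; rewrite in_itv/= andbT.
by rewrite -[_ @^-1` _]setTI; exact: mf.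
Qed.

Section increments.
Variables (p : nat -> R) (m : nat) (eta del M : R).
Hypothesis p0 : 0 <= p 0%N.
Hypothesis p_mono : nondecreasing_seq p.
Hypothesis eta0 : 0 < eta.
Hypothesis del0 : 0 <= del.
Hypothesis M0 : 0 <= M.

Let p_ge0 i : 0 <= p i. Proof. by rewrite (le_trans p0)// p_mono. Qed.

(** The increments are required to be nonnegative, although they are so off
    N, in order that the event be determined by the clock alone: the null set N
    also depends on W. *)
Definition clock_small : set Om :=
  [set w | th (p m) w <= M /\ forall i, (i < m)%N ->
     0 <= th (p i.+1) w - th (p i) w <= del].

(* The quantity to be bounded, and the same with the clock rounded down. *)
Let Q w := \sum_(i < m) centered_increment W (th (p i) w) (th (p i.+1) w) w.
Let Qk k w := \sum_(i < m) centered_increment W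
   (mesh_floor k (th (p i) w)) (mesh_floor k (th (p i.+1) w)) w.

Notation GT := (g_sigma_algebraType (\bigcup_(i in `[0, +oo[)
     preimage_set_system setT (T i) measurable)).
Notation GW := (g_sigma_algebraType (\bigcup_(i in `[0, +oo[)
     preimage_set_system setT (W i) measurable)).

Let mthG t : 0 <= t -> measurable_fun (T := GT) setT (fun w => th t w).
Proof.
move=> t0; apply: measurableT_comp => //.
by apply: sigma_process_measurable; rewrite /= in_itv/= t0.
Qed.

Let measurable_clock_small_gen d' (Om' : measurableType d') (f : nat -> Om' -> R) :
  (forall i, measurable_fun setT (f i)) ->
  measurable [set w | f m w <= M /\ forall i, (i < m)%N ->
     0 <= f i.+1 w - f i w <= del].
Proof.
move=> mf.
have -> : [set w | f m w <= M /\ forall i, (i < m)%N ->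
     0 <= f i.+1 w - f i w <= del] =
  (f m @^-1` `]-oo, M]%classic) `&`
  \bigcap_(i in [set i | (i < m)%N]) ((fun w => f i.+1 w - f i w) @^-1` `[0, del]%classic).
  apply/seteqP; split => w /=.
    by move=> [h1 h2]; split => [|i /= /h2]; rewrite in_itv.
  by move=> [h1 h2]; split => [|i /= /h2]; rewrite ?in_itv//= in h1 *; rewrite in_itv.
apply: measurableI.
  by rewrite -[_ @^-1` _]setTI; exact: mf.
apply: bigcap_measurableType => i _.
rewrite -[_ @^-1` _]setTI.
have : measurable_fun setT (fun w => f i.+1 w - f i w) by apply: measurable_funB.
by apply.
Qed.

(* The rounded values of the clock on the partition, coded as a single natural
   number, and the deterministic clock decoded from it; the latter is constant
   from index m on, which makes it nondecreasing on all of nat. *)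
Let phi k w := pickle [seq mesh_index k (th (p i) w) | i <- iota 0 m.+1].
Let tau k (n : nat) (i : nat) : R :=
  (nth 0%N (odflt [::] (unpickle n)) (minn i m))%:R / k.+1%:R.
Let A k n := [set w | eta <=
  `|\sum_(i < m) centered_increment W (tau k n i) (tau k n i.+1) w| ].

Let tauE k w i : tau k (phi k w) i = mesh_floor k (th (p (minn i m)) w).
Proof.
have E : odflt [::] (unpickle (phi k w)) =
  [seq mesh_index k (th (p i) w) | i <- iota 0 m.+1] by rewrite /phi pickleK.
rewrite /tau E (nth_map 0%N) ?size_iota ?ltnS ?geq_minr// nth_iota ?add0n//.
by rewrite ltnS geq_minr.
Qed.

Let measurable_abs_ge d' (Om' : measurableType d') (h : Om' -> R) :
  measurable_fun setT h -> measurable [set w | eta <= `|h w|].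
Proof.
move=> mh; have -> : [set w | eta <= `|h w|] = (fun w => `|h w|) @^-1` `[eta, +oo[%classic.
  by apply/seteqP; split => w /=; rewrite in_itv/= andbT.
rewrite -[_ @^-1` _]setTI.
have : measurable_fun setT (fun w => `|h w|) by apply: measurableT_comp.
by apply.
Qed.

Let measurable_phi d' (Om' : measurableType d') (f : nat -> Om' -> R) k n :
  (forall i, measurable_fun setT (f i)) -> (forall i w, 0 <= f i w) ->
  measurable [set w | pickle [seq mesh_index k (f i w) | i <- iota 0 m.+1] = n].
Proof.
move=> mf f0.
have [l|] := eqVneq (pickle (odflt [::] (@unpickle (seq nat) n))) n.
  rewrite (_ : [set _ | _] = [set w | [seq mesh_index k (f i w) | i <- iota 0 m.+1] =
      odflt [::] (unpickle n)]).
    by apply: measurable_map_eq => i j; exact: measurable_mesh_index.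
  apply/seteqP; split => w; rewrite /mkset; first by move=> <-; rewrite pickleK.
  by move=> ->.
move=> nn; rewrite (_ : [set _ | _] = set0)//.
apply/seteqP; split => w //; rewrite /mkset => ww; move/eqP: nn; apply.
by rewrite -ww pickleK.
Qed.

(** On an atom of the rounded clock, W runs along a deterministic partition,
    and [centered_sum_tail] applies.  Rounding increases an increment by at most
    1 / k.+1. *)
Lemma tail_mesh k :
  (P [set w | clock_small w /\ (eta <= `|Qk k w|)%R]
    <= (2 * (del + k.+1%:R^-1) * M / eta ^+ 2)%:E)%E.
Proof.
have k0 : 0 <= k.+1%:R^-1 :> R by rewrite invr_ge0.
have -> : [set w | clock_small w /\ (eta <= `|Qk k w|)%R] =
    [set w | clock_small w /\ A k (phi k w) w].
  apply/seteqP; split => w /= [Bw h]; split => //; move: h;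
   rewrite /A /Qk /=; congr (_ <= `|_|); apply: eq_bigr => i _;
   by rewrite !tauE !(minn_idPl _)// ltnW.
have tau0 n i : 0 <= tau k n i by rewrite divr_ge0.
apply: (@independent_discrete_bound _ _ _ P _ _ (phi k) (A k) clock_small _ WT_ind).
- move=> n; apply: (@measurable_abs_ge _ GW).
  apply: measurable_sum => i; apply: measurable_funB => //; apply: measurable_funX.
  by apply: measurable_funB; apply: sigma_process_measurable;
    rewrite /= in_itv/= tau0.
- move=> n; apply: measurable_abs_ge.
  apply: measurable_sum => i; apply: measurable_funB => //; apply: measurable_funX.
  by case: W_BM => mW _ _ _ _; apply: measurable_funB; apply: mW; exact: tau0.
- move=> n; apply: (@measurableI _ GT).
    by apply: (@measurable_clock_small_gen _ GT (fun i w => th (p i) w)) => i; exact: mthG.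
  apply: (@measurable_phi _ GT (fun i w => th (p i) w)); first by move=> i; exact: mthG.
  by move=> i w; exact: clock_ge0.
- move=> n; apply: measurableI.
    by apply: measurable_clock_small_gen => i; exact: measurable_clock.
  apply: (@measurable_phi _ Om (fun i w => th (p i) w)); first by move=> i; exact: measurable_clock.
  by move=> i w; exact: clock_ge0.
- by apply: measurable_clock_small_gen => i; exact: measurable_clock.
- by rewrite divr_ge0// ?exprn_ge0 ?(ltW eta0)// mulr_ge0// mulr_ge0// addr_ge0.
move=> w [thM thi].
have mono i : (i < m)%N -> th (p i) w <= th (p i.+1) w.
  by move=> /thi /andP[]; rewrite subr_ge0.
have nd : nondecreasing_seq (tau k (phi k w)).
  apply/nondecreasing_seqP => i; rewrite !tauE; apply: le_mesh_floor.
  have [im|mi] := ltnP i m; last by rewrite !(minn_idPr _)// ltnW.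
  by rewrite !(minn_idPl _)// ?mono// ltnW.
apply: le_trans (centered_sum_tail W_BM (del := del + k.+1%:R^-1) (m := m) _ nd eta0 _ _) _ => //.
- by rewrite addr_ge0.
- move=> i im; rewrite !tauE !(minn_idPl _)//; last exact: ltnW.
  have /andP[h1 h2] := mesh_floor_itv k (clock_ge0 w (p_ge0 i)).
  have /andP[h3 h4] := mesh_floor_itv k (clock_ge0 w (p_ge0 i.+1)).
  have /andP[h5 h6] := thi i im.
  rewrite lerBlDr (le_trans h3)// -lerBlDr.
  move: h2 h6; move: (k.+1%:R^-1 : R) => r; lra.
rewrite lee_fin ler_wpM2r ?invr_ge0 ?exprn_ge0 ?(ltW eta0)//.
rewrite ler_wpM2l ?mulr_ge0 ?addr_ge0//.
rewrite tauE minnn (le_trans _ thM)//.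
by have /andP[] := mesh_floor_itv k (clock_ge0 w (p_ge0 m)).
Qed.

Lemma measurable_clock_small : measurable clock_small.
Proof. by apply: measurable_clock_small_gen => i; exact: measurable_clock. Qed.

Lemma measurable_Q : measurable_fun setT Q.
Proof.
apply: measurable_sum => i; apply: measurable_funB.
  by apply: measurable_funX; apply: measurable_funB; apply: measurable_time_changed.
by apply: measurable_funB; exact: measurable_clock.
Qed.

Lemma measurable_Qk k : measurable_fun setT (Qk k).
Proof.
have mm t : 0 <= t -> measurable_fun setT (fun w => mesh_floor k (th t w)).
  move=> t0; apply: (measurableT_comp (f := mesh_floor k)); last exact: measurable_clock.
  by apply: nondecreasing_measurable => // x y; exact: le_mesh_floor.
apply: measurable_sum => i; apply: measurable_funB.
  by apply: measurable_funX; apply: measurable_funB; apply: measurable_W_mesh.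
by apply: measurable_funB; exact: mm.
Qed.

Lemma Qk_cvg w : ~ N w -> Qk k w @[k --> \oo] --> Q w.
Proof.
move=> Nw; apply: cvg_big => [|i _]; first exact: add_continuous.
have cmf j : mesh_floor k (th (p j) w) @[k --> \oo] --> th (p j) w.
  by apply: mesh_floor_cvg; exact: clock_ge0.
have cW j : W (mesh_floor k (th (p j) w)) w @[k --> \oo] --> W (th (p j) w) w.
  by apply: W_path_cvg => //; exact: clock_ge0.
rewrite /centered_increment; apply: cvgB; last by apply: cvgB.
by apply: cvgM; apply: cvgB.
Qed.

Lemma measurable_tail_increments :
  measurable ([set w | (eta < `|Q w|)%R] `&` clock_small).
Proof.
apply: measurableI; last exact: measurable_clock_small.
by apply: measurable_cst_lt; apply: measurableT_comp => //; exact: measurable_Q.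
Qed.

(** Passage to the limit in [tail_mesh]: the strict inequality eta < `|Q w|
    holds for the rounded clock as well as soon as k is large, by [Qk_cvg]. *)
Lemma tail_increments :
  (P ([set w | (eta < `|Q w|)%R] `&` clock_small) <= (2 * del * M / eta ^+ 2)%:E)%E.
Proof.
set E := _ `&` clock_small.
have mE : measurable E by exact: measurable_tail_increments.
pose Ek k := [set w | (eta <= `|Qk k w|)%R].
have mEk k : measurable (Ek k) by apply: measurable_abs_ge; exact: measurable_Qk.
have H0 : P (E `\` Ek k) @[k --> \oo] --> 0%E.
  apply: (@eventually_notin_cvg0 _ _ _ P _ N) => //.
    by move=> k; apply: measurableD.
  move=> w Nw; have [Ew|] := pselect (E w); last by move=> nE; apply: nearW => k [].
  have /cvg_norm cQ := Qk_cvg Nw.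
  have etaQ : eta < `|Q w| by case: Ew.
  near=> k; move=> [_]; apply; rewrite /Ek /=; apply/ltW.
  near: k; exact: cvgr_gt cQ _ etaQ.
have H1 : ((2 * (del + k.+1%:R^-1) * M / eta ^+ 2)%:E)%E @[k --> \oo] -->
    (2 * del * M / eta ^+ 2)%:E.
  apply: cvg_EFin; first exact: nearW.
  apply: cvgM; last exact: cvg_cst.
  apply: cvgM; last exact: cvg_cst.
  apply: cvgM; first exact: cvg_cst.
  rewrite -[X in _ --> X]addr0; apply: cvgD; first exact: cvg_cst.
  exact: cvg_harmonic.
have H2 := cvgeD (isT : ((2 * del * M / eta ^+ 2)%:E +? 0)%E) H1 H0.
rewrite adde0 in H2; apply: (cvge_to_ge (H2 _)).
apply: nearW => k /=.
apply: (@le_trans _ _ (P ((clock_small `&` Ek k) `|` (E `\` Ek k)))%E).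
  rewrite le_measure ?inE//.
    apply: measurableU; last exact: measurableD.
    by apply: measurableI => //; exact: measurable_clock_small.
  move=> w Ew; have [Ekw|Ekw] := pselect (Ek k w); last by right.
  by left; split => //; case: Ew.
apply: le_trans (measureU2 _ _ _) _.
- by apply: measurableI => //; exact: measurable_clock_small.
- exact: measurableD.
by apply: leeD => //; exact: tail_mesh.
Unshelve. all: end_near. Qed.

End increments.

Lemma prob_cvg0P (A : (set Om)^nat) : (forall n, measurable (A n)) ->
  (forall e, 0 < e -> \forall n \near \oo, (P (A n) <= e%:E)%E) ->
  P (A n) @[n --> \oo] --> 0%E.
Proof.
move=> mA H; apply/fine_cvgP; split.
  by apply: nearW => n; apply: fin_num_measure.
apply/cvgr0Pnorm_le => e e0; have := H e e0; apply: filterS => n Hn.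
rewrite /= ger0_norm ?fine_ge0// -lee_fin fineK//.
by apply: fin_num_measure.
Qed.

Lemma prob_cvg0_le (A : (set Om)^nat) : P (A n) @[n --> \oo] --> 0%E ->
  forall e, 0 < e -> \forall n \near \oo, (P (A n) <= e%:E)%E.
Proof.
move=> /fine_cvgP[fA /cvgr0Pnorm_le H] e e0.
near=> n.
have An : P (A n) \is a fin_num by near: n.
rewrite -[P (A n)]fineK// lee_fin.
by apply: le_trans (ler_norm _) _; near: n; exact: H.
Unshelve. all: end_near. Qed.

(** Truncation at t makes t itself the last point of the grid, whether or not
    n * t is an integer. *)
Definition grid (n : nat) (t : R) (i : nat) : R := Num.min (i%:R / n%:R) t.

Lemma grid_ge0 n t (i : nat) : 0 <= t -> 0 <= grid n t i.
Proof. by move=> t0; rewrite le_min t0 divr_ge0. Qed.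

Lemma grid_nondecreasing n t : nondecreasing_seq (grid n t).
Proof.
move=> i j ij; rewrite /grid le_min ge_min [X in _ && X]ge_min lexx orbT andbT.
by rewrite ler_wpM2r ?invr_ge0// ler_nat.
Qed.

Lemma grid_last n t : (0 < n)%N -> 0 <= t -> grid n t (Num.truncn (n%:R * t)).+1 = t.
Proof.
move=> n0 t0; rewrite /grid min_r//.
have /andP[_ h] := truncn_itv (mulr_ge0 (ler0n R n) t0).
by rewrite ler_pdivlMr ?ltr0n// mulrC ltW.
Qed.

Lemma gridE n t (i : nat) : 0 <= t -> (i <= Num.truncn (n%:R * t))%N -> grid n t i = i%:R / n%:R.
Proof.
move=> t0 im; rewrite /grid min_l//.
have [->|n0] := posnP n; first by rewrite invr0 mulr0.
rewrite ler_pdivrMr ?ltr0n// mulrC.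
have /andP[h _] := truncn_itv (mulr_ge0 (ler0n R n) t0).
by rewrite (le_trans _ h)// ler_nat.
Qed.

Lemma grid_step n t (i : nat) : (0 < n)%N -> grid n t i.+1 - grid n t i <= n%:R^-1.
Proof.
move=> n0; rewrite /grid.
have -> : i.+1%:R / n%:R = i%:R / n%:R + n%:R^-1 :> R.
  by rewrite -natr1 mulrDl mul1r.
have : 0 <= n%:R^-1 :> R by rewrite invr_ge0.
move: (n%:R^-1 : R) => c c0; move: (i%:R * c) => a.
by case: (leP (a + c) t); case: (leP a t); lra.
Qed.

Definition clock_jump (t del : R) (n : nat) : set Om :=
  \big[setU/set0]_(i < (Num.truncn (n%:R * t)).+1)
    [set w | del < th (grid n t i.+1) w - th (grid n t i) w].

Lemma clock_jumpP t del n w : clock_jump t del n w <->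
  exists2 i, (i <= Num.truncn (n%:R * t))%N & del < th (grid n t i.+1) w - th (grid n t i) w.
Proof.
rewrite /clock_jump -(bigcup_mkord _ (fun i => [set w | del < th (grid n t i.+1) w - th (grid n t i) w])).
by split => -[i /= im h]; exists i.
Qed.

Lemma measurable_clock_jump t del n : 0 <= t -> measurable (clock_jump t del n).
Proof.
move=> t0; apply: bigsetU_measurable => i _.
by apply: measurable_cst_lt; apply: measurable_funB; apply: measurable_clock; exact: grid_ge0.
Qed.

(** Each path of the clock off N is uniformly continuous on [0, t]. *)
Lemma clock_jump_cvg0 t del : 0 <= t -> 0 < del ->
  P (clock_jump t del n) @[n --> \oo] --> 0%E.
Proof.
move=> t0 del0; apply: (@eventually_notin_cvg0 _ _ _ P _ N) => //.
  by move=> n; exact: measurable_clock_jump.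
move=> w Nw.
have [r r0 Hr] := heine (clock_continuous (b := t) Nw) del0.
near=> n; move=> /clock_jumpP[i im].
have n0 : (0 < n)%N by near: n; exact: nbhs_infty_gt.
apply/negP; rewrite -leNgt (le_trans (ler_norm _))//.
have g01 j : grid n t j \in `[0, t].
  by rewrite in_itv/= grid_ge0//= ge_min lexx orbT.
apply: Hr => //.
rewrite ger0_norm ?subr_ge0 ?grid_nondecreasing//.
rewrite (le_trans (grid_step t i n0))//.
rewrite -(prednK n0); apply/ltW.
near: n; exists (Num.truncn r^-1).+1 => // n /= rn.
rewrite prednK; last exact: leq_ltn_trans rn.
rewrite invf_plt ?posrE// ?ltr0n; last exact: leq_ltn_trans rn.
by rewrite (lt_le_trans (truncnS_gt _))// ler_nat.
Unshelve. all: end_near. Qed.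

Lemma realized_variationE n t w :
  realized_variation X n t w =
  \sum_(i < Num.truncn (n%:R * t)) (X (i.+1%:R / n%:R) w - X (i%:R / n%:R) w) ^+ 2.
Proof. by rewrite /realized_variation big_add1 big_mkord. Qed.

Lemma realized_variation_ge0 n t w : 0 <= realized_variation X n t w.
Proof. by rewrite realized_variationE sumr_ge0// => i _; exact: sqr_ge0. Qed.

Lemma realized_variation_mono n s t w : s <= t ->
  realized_variation X n s w <= realized_variation X n t w.
Proof.
move=> st; rewrite !realized_variationE.
have st' : (Num.truncn (n%:R * s) <= Num.truncn (n%:R * t))%N.
  by apply: le_truncn; rewrite ler_wpM2l.
rewrite -!(big_mkord xpredT (fun i => (X (i.+1%:R / n%:R) w - X (i%:R / n%:R) w) ^+ 2)).
rewrite (@big_cat_nat _ _ _ (Num.truncn (n%:R * s)) 0 (Num.truncn (n%:R * t)))//=.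
by rewrite lerDl sumr_ge0// => i _; exact: sqr_ge0.
Qed.

Lemma measurable_realized_variation n t :
  measurable_fun setT (realized_variation X n t).
Proof.
apply: (eq_measurable_fun (fun w => \sum_(i < Num.truncn (n%:R * t))
  (X (i.+1%:R / n%:R) w - X (i%:R / n%:R) w) ^+ 2)).
  by move=> w _; rewrite realized_variationE.
apply: measurable_sum => i; apply: measurable_funX.
by apply: measurable_funB; apply: measurable_time_changed; rewrite divr_ge0.
Qed.

Definition rv_error (t eta : R) (n : nat) : set Om :=
  [set w | eta < `|realized_variation X n t w - th t w|].

Lemma measurable_rv_error t eta n : 0 <= t -> measurable (rv_error t eta n).
Proof.
move=> t0; apply: measurable_cst_lt; apply: measurableT_comp => //.
by apply: measurable_funB; [exact: measurable_realized_variation|exact: measurable_clock].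
Qed.

Lemma clock_tail_cvg0 t : 0 <= t ->
  P [set w | k%:R < th t w] @[k --> \oo] --> 0%E.
Proof.
move=> t0; apply: (@eventually_notin_cvg0 _ _ _ P _ N) => //.
  by move=> k; apply: measurable_cst_lt; exact: measurable_clock.
move=> w Nw; exists (Num.truncn (th t w)).+1 => // k /= tk.
apply/negP; rewrite -leNgt ltW// (lt_le_trans (truncnS_gt _))// ler_nat//.
Qed.

(** Off the events that the clock exceeds M by time t, that it jumps by more
    than del over a step of the grid, and that the centred sum exceeds eta / 2,
    the error is at most eta / 2 + del: the second term accounts for the time
    elapsed since the last point of the partition.  First M is chosen, then del,
    then n. *)
Lemma rv_error_cvg0 t eta : 0 <= t -> 0 < eta ->
  P (rv_error t eta n) @[n --> \oo] --> 0%E.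
Proof.
move=> t0 eta0; apply: prob_cvg0P => [n|e e0]; first exact: measurable_rv_error.
have e30 : 0 < e / 3 by rewrite divr_gt0.
have [M _ /(_ M (leqnn M)) HM] := prob_cvg0_le (clock_tail_cvg0 t0) e30.
pose eta2 := eta / 2.
have eta20 : 0 < eta2 by rewrite divr_gt0.
pose del := Num.min eta2 (e / 3 * eta2 ^+ 2 / (2 * M.+1%:R)).
have del0 : 0 < del.
  by rewrite lt_min eta20/= divr_gt0// ?mulr_gt0// exprn_gt0.
near=> n.
have n0 : (0 < n)%N by near: n; exact: nbhs_infty_gt.
have HD : (P (clock_jump t del n) <= (e / 3)%:E)%E.
  by near: n; exact: prob_cvg0_le (clock_jump_cvg0 t0 del0) _ e30.
pose m := Num.truncn (n%:R * t).
pose p := grid n t.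
have p0 : 0 <= p 0%N by exact: grid_ge0.
have pm : nondecreasing_seq p by exact: grid_nondecreasing.
have M0 : 0 <= M%:R :> R by [].
have := tail_increments m p0 pm eta20 (ltW del0) M0.
set Q := (X in (P X <= _)%E) => HQ.
have mQ : measurable Q by exact: measurable_tail_increments.
have mD := measurable_clock_jump del n t0.
have mM : measurable [set w | M%:R < th t w].
  by apply: measurable_cst_lt; exact: measurable_clock.
have sub : rv_error t eta n `<=` N `|` [set w | M%:R < th t w] `|` clock_jump t del n `|` Q.
  move=> w Ew; have [Nw|Nw] := pselect (N w); first by do 3 left.
  have [Mw|Mw] := ltP M%:R (th t w); first by left; left; right.
  have [Dw|Dw] := pselect (clock_jump t del n w); first by left; right.
  right.
  have inc i : (i <= m)%N -> th (p i.+1) w - th (p i) w <= del.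
    by move=> im; rewrite leNgt; apply/negP => h; apply: Dw; apply/clock_jumpP; exists i.
  have pt : p m <= t by rewrite ge_min lexx orbT.
  split; last first.
    split; first by rewrite (le_trans _ Mw)// clock_mono// grid_ge0.
    move=> i im; rewrite inc ?(ltnW im)// subr_ge0 clock_mono ?grid_ge0//.
    by rewrite pm.
  have RE : realized_variation X n t w =
     \sum_(i < m) centered_increment W (th (p i) w) (th (p i.+1) w) w + th (p m) w.
    rewrite realized_variationE /centered_increment big_split/= -addrA -[LHS]addr0.
    congr +%R.
      apply: eq_bigr => i _; rewrite /time_changed /p !gridE//; exact: ltnW.
    rewrite sumrN -(big_mkord xpredT (fun i => th (p i.+1) w - th (p i) w)) telescope_sumr//.
    have -> : p 0%N = 0 by rewrite /p gridE// mul0r.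
    by rewrite T_start//= subr0 addNr.
  have := inc m (leqnn m).
  have -> : p m.+1 = t by exact: grid_last.
  have := clock_mono Nw (grid_ge0 n m t0) pt.
  move: Ew; rewrite /rv_error /= RE.
  have : del <= eta2 by rewrite ge_min lexx.
  rewrite /eta2; set q := \sum_(i < m) _.
  move=> d2 Ew tm inm.
  rewrite ltNge; apply/negP => hq; move: Ew; apply/negP; rewrite -leNgt.
  move: hq; rewrite !ler_norml => /andP[? ?].
  move: (th (p m) w) (th t w) tm inm => a b tm inm.
  by apply/andP; split; lra.
have c3 : 2 * del * M%:R / eta2 ^+ 2 <= e / 3.
  have : del <= e / 3 * eta2 ^+ 2 / (2 * M.+1%:R) by rewrite ge_min lexx orbT.
  rewrite ler_pdivlMr ?mulr_gt0// => h.
  rewrite ler_pdivrMr ?exprn_gt0// (le_trans _ h)//.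
  by rewrite mulrCA mulrA ler_wpM2l ?mulr_ge0 ?(ltW del0)// ler_nat.
apply: (@le_trans _ _ (P (N `|` [set w | M%:R < th t w] `|` clock_jump t del n `|` Q))).
  rewrite le_measure ?inE//; first exact: measurable_rv_error.
  by do 3 apply: measurableU => //.
apply: le_trans (measureU2 _ _ _) _ => //; first by do 2 apply: measurableU => //.
have -> : e = e / 3 + e / 3 + e / 3 by field.
rewrite EFinD; apply: leeD; last by apply: le_trans HQ _; rewrite lee_fin.
apply: le_trans (measureU2 _ _ _) _ => //; first by apply: measurableU.
rewrite EFinD; apply: leeD; last exact: HD.
apply: le_trans (measureU2 _ _ _) _ => //.
by rewrite [X in (X + _)%E]N0 add0e.
Unshelve. all: end_near. Qed.

(** Dini's argument: between two points of a fixed grid, both nondecreasing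
    functions are squeezed between their values at these points.  B is a measurable
    event containing the one that the error is somewhere larger than eta, which
    involves uncountably many times. *)
Lemma realized_variation_ucp tmax eta e : 0 <= tmax -> 0 < eta -> 0 < e ->
  \forall n \near \oo, exists2 B, measurable B & (P B <= e%:E)%E /\
    forall w, ~ B w -> forall s, 0 <= s <= tmax ->
      `|realized_variation X n s w - th s w| <= eta.
Proof.
move=> t0 eta0 e0.
have e20 : 0 < e / 2 by rewrite divr_gt0.
have eta20 : 0 < eta / 2 by rewrite divr_gt0.
have [K0 _ HK0] := prob_cvg0_le (clock_jump_cvg0 t0 eta20) e20.
pose K := K0.+1.
have HK := HK0 K (leqnSn K0).
(* The grid has the points 0 / K, ..., (J - 2) / K and tmax. *)
pose J := (Num.truncn (K%:R * tmax)).+2.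
pose q := grid K tmax.
have q0 i : 0 <= q i by exact: grid_ge0.
have Hsum : (\sum_(j < J) P (rv_error (q j) (eta / 2) n))%E @[n --> \oo] --> 0%E.
  have g0 (j : 'I_J) : true -> \forall n \near \oo, (0 <= P (rv_error (q j) (eta / 2) n))%E.
    by move=> _; apply: nearW => n; exact: measure_ge0.
  have gc (j : 'I_J) : true -> P (rv_error (q j) (eta / 2) n) @[n --> \oo] --> 0%E.
    by move=> _; exact: rv_error_cvg0.
  by have := cvg_nnesum (r := index_enum 'I_J) g0 gc; rewrite big1 => // h; exact: h _.
have Hev : \forall n \near \oo, (\sum_(j < J) P (rv_error (q j) (eta / 2) n) <= (e / 2)%:E)%E.
  move/fine_cvgP : Hsum => [fA /cvgr0Pnorm_le H].
  near=> n.
  have An : (\sum_(j < J) P (rv_error (q j) (eta / 2) n))%E \is a fin_num by near: n.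
  rewrite -[leLHS]fineK// lee_fin.
  by apply: le_trans (ler_norm _) _; near: n; exact: H.
near=> n.
pose U := \big[setU/set0]_(j < J) rv_error (q j) (eta / 2) n.
have mU : measurable U.
  by apply: bigsetU_measurable => j _; exact: measurable_rv_error.
have mD := measurable_clock_jump (eta / 2) K t0.
exists (N `|` clock_jump tmax (eta / 2) K `|` U).
  by do 2 apply: measurableU => //.
split.
  apply: le_trans (measureU2 _ _ _) _ => //; first by apply: measurableU.
  rewrite (splitr e) EFinD; apply: leeD.
    apply: le_trans (measureU2 _ _ _) _ => //.
    by rewrite [X in (X + _)%E]N0 add0e.
  apply: (@le_trans _ _ (\sum_(j < J) P (rv_error (q j) (eta / 2) n))%E).
    apply: (@content_subadditive _ _ _ P U (fun j => rv_error (q j) (eta / 2) n) J) => //.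
    by move=> k _; exact: measurable_rv_error.
  by near: n.
move=> w NB s /andP[s0 st].
have Nw : ~ N w by move=> Nw; apply: NB; left; left.
have inc i : (i <= Num.truncn (K%:R * tmax))%N -> th (q i.+1) w - th (q i) w <= eta / 2.
  move=> im; rewrite leNgt; apply/negP => h; apply: NB; left; right.
  by apply/clock_jumpP; exists i.
have err j : (j < J)%N -> `|realized_variation X n (q j) w - th (q j) w| <= eta / 2.
  move=> jJ; rewrite leNgt; apply/negP => h; apply: NB; right.
  by rewrite /U -(bigcup_mkord _ (fun j => rv_error (q j) (eta / 2) n)); exists j.
pose j := Num.truncn (K%:R * s).
have jm : (j <= Num.truncn (K%:R * tmax))%N.
  by apply: le_truncn; rewrite ler_wpM2l.
have /andP[h1 h2] := truncn_itv (mulr_ge0 (ler0n R K) s0).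
have qs : q j <= s.
  by rewrite /q gridE// ler_pdivrMr// mulrC.
have sq : s <= q j.+1.
  by rewrite /q /grid le_min st andbT ler_pdivlMr// mulrC ltW.
have e1 := err j (leq_trans jm (leqnSn _)).
have e2 := err j.+1 (jm : (j.+1 < J)%N).
have i1 := inc j jm.
have r1 := realized_variation_mono n w qs.
have r2 := realized_variation_mono n w sq.
have c1 := clock_mono Nw (q0 j) qs.
have c2 := clock_mono Nw s0 sq.
move: e1 e2 i1 r1 r2 c1 c2; rewrite !ler_norml.
move: (realized_variation X n (q j) w) (realized_variation X n s w)
  (realized_variation X n (q j.+1) w) (th (q j) w) (th s w) (th (q j.+1) w).
move=> a b c a' b' c' /andP[? ?] /andP[? ?] ? ? ? ? ?.
by apply/andP; split; lra.
Unshelve. all: end_near. Qed.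

Section copula_estimation.
Variables (u v t0 tmax : R).
Hypothesis u01 : 0 <= u <= 1.
Hypothesis v01 : 0 <= v <= 1.
Hypothesis t00 : 0 <= t0.
Hypothesis t0max : t0 < tmax.
Hypothesis T_pos : forall w, ~ N w -> (0 < T t0 w)%E.

Let Z n s t w := `|cond_copula T s t u v w - copula_estimator X n s t u v w|.

Lemma measurable_copula_error n s t : 0 <= s -> 0 <= t ->
  measurable_fun setT (Z n s t).
Proof.
move=> s0 t0'; apply: measurableT_comp => //; apply: measurable_funB.
  by apply: measurable_psi => //; do ?exact: measurable_clock; move=> w; exact: clock_ge0.
apply: measurable_psi => //; do ?exact: measurable_realized_variation;
  by move=> w; exact: realized_variation_ge0.
Qed.

Lemma clock_pos w : ~ N w -> 0 < th t0 w.
Proof.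
move=> Nw; rewrite fine_gt0// T_pos//= T_fin//.
Qed.

Let D (q : rat) : R := if t0 <= ratr q <= tmax then ratr q else tmax.

Let D_itv q : t0 <= D q <= tmax.
Proof. by rewrite /D; case: ifPn => // _; rewrite lexx ltW. Qed.

(** A rational time slightly to the right of s, within the same step of the
    realized variation; the time tmax has to be its own approximation. *)
Lemma right_approximation n w s rho : (0 < n)%N -> ~ N w -> t0 <= s <= tmax -> 0 < rho ->
  exists2 q, Num.truncn (n%:R * D q) = Num.truncn (n%:R * s) &
    `|th s w - th (D q) w| <= rho.
Proof.
move=> n0 Nw /andP[ts st] rho0.
have s0 : 0 <= s := le_trans t00 ts.
move: st; rewrite le_eqVlt => /orP[/eqP stmax|st].
  exists ((Num.truncn tmax).+1%:R).
    rewrite /D ratr_nat leNgt [in X in ~~ X && _]ltNge.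
    rewrite [_ <= tmax]leNgt truncnS_gt andbF; congr Num.truncn; by rewrite stmax.
  by rewrite /D ratr_nat [_ <= tmax]leNgt truncnS_gt andbF stmax subrr normr0 ltW.
have [r r0 Hr] := heine (clock_continuous (b := tmax) Nw) rho0.
have /andP[h1 h2] := truncn_itv (mulr_ge0 (ler0n R n) s0).
pose b := Num.min tmax (Num.min (s + r) ((Num.truncn (n%:R * s)).+1%:R / n%:R)).
have sb : s < b.
  by rewrite !lt_min st ltrDl r0/= ltr_pdivlMr ?ltr0n// mulrC.
have [q] := rat_in_itvoo sb; rewrite in_itv/= !lt_min => /and4P[sq qt qr qn].
have Dq : D q = ratr q.
  by rewrite /D (le_trans ts (ltW sq)) ltW.
exists q; rewrite Dq.
  apply: truncn_def; rewrite (le_trans h1) ?ler_pM2l ?ltr0n// ?ltW//=.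
  by rewrite mulrC -ltr_pdivlMr ?ltr0n.
apply: Hr.
- by rewrite in_itv/= s0 ltW.
- by rewrite in_itv/= (le_trans s0 (ltW sq)) ltW.
by rewrite ltr0_norm ?subr_lt0// opprB lerBlDl ltW.
Qed.

(** Replacing s and t by such rational times does not change the estimator,
    and moves the copula by at most gap. *)
Lemma copula_error_rational n w s t gap : (0 < n)%N -> ~ N w ->
  t0 <= s <= tmax -> t0 <= t <= tmax -> 0 < gap ->
  exists q r, Z n s t w - gap <= Z n (D q) (D r) w.
Proof.
move=> n0 Nw sI tI gap0.
have [rho rho0 Hrho] := psi_uniformly_continuous u01 v01 (clock_pos Nw) gap0.
have [q nq hq] := right_approximation n0 Nw sI rho0.
have [r nr hr] := right_approximation n0 Nw tI rho0.
exists q, r.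
have rvE a b : Num.truncn (n%:R * a) = Num.truncn (n%:R * b) ->
    realized_variation X n a w = realized_variation X n b w.
  by rewrite !realized_variationE => ->.
rewrite /Z /copula_estimator (rvE _ _ nq) (rvE _ _ nr) /cond_copula.
have pos x : t0 <= x <= tmax -> 0 <= x by move=> /andP[+ _]; exact: le_trans.
have := Hrho (th s w) (th t w) (th (D q) w) (th (D r) w)
  (clock_ge0 w (pos _ sI)) (clock_ge0 w (pos _ tI))
  (clock_ge0 w (pos _ (D_itv q))) (clock_ge0 w (pos _ (D_itv r))) _ hq hr.
have -> : th t0 w <= Num.max (th s w) (th t w).
  by rewrite le_max clock_mono//; case/andP: sI.
move=> /(_ isT).
move: (psi _ _ u v) (psi _ _ u v) (psi _ _ u v) => a b c ab.
rewrite lerBlDl (le_trans _ (lerD ab (lexx _)))//.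
by rewrite (le_trans _ (ler_normD _ _))// addrA subrK.
Qed.

Definition copula_deviation (eps : R) (n : nat) : set Om :=
  [set w | (eps%:E <=
       ereal_sup [set (Z n s t w)%:E | s in `[t0, tmax] & t in `[t0, tmax]])%E].

(** Off N, the supremum reaches eps if and only if for each k some pair of
    rational times has an error larger than eps - 1 / k.+1. *)
Lemma measurable_copula_deviation eps n : (0 < n)%N ->
  measurable (copula_deviation eps n).
Proof.
move=> n0.
apply: (@null_set_measurable _ (\bigcap_k \bigcup_(qr : rat * rat)
   [set w | eps - k.+1%:R^-1 < Z n (D qr.1) (D qr.2) w])).
  apply: bigcapT_measurable => k; apply: countable_bigcupT_measurable => [|[q r]].
    exact: countableP.
  have pos x : 0 <= D x by have /andP[+ _] := D_itv x; exact: le_trans.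
  by apply: measurable_cst_lt; exact: measurable_copula_error.
move=> w Nw; split; rewrite /copula_deviation /=.
  move=> hsup k _ /=.
  have : ((eps - k.+1%:R^-1)%:E < ereal_sup
      [set (Z n s t w)%:E | s in `[t0, tmax] & t in `[t0, tmax]])%E.
    by apply: lt_le_trans hsup; rewrite lte_fin ltrBlDl ltrDr invr_gt0.
  move=> /ereal_sup_gt[_ [s /= sI [t tI <-]]]; rewrite lte_fin => hZ.
  have gap0 : 0 < (Z n s t w - (eps - k.+1%:R^-1)) / 2.
    by rewrite divr_gt0// subr_gt0.
  move: sI tI; rewrite !in_itv/= => sI tI.
  have [q [r qr]] := copula_error_rational n0 Nw sI tI gap0.
  exists (q, r) => //=; apply: lt_le_trans qr.
  move: gap0 hZ; move: (Z n s t w) (eps - _) => a b; lra.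
move=> H; apply/lee_subgt0Pr => e e0.
have [k ke] : exists k : nat, k.+1%:R^-1 <= e.
  have [k _ hk] := near_infty_natSinv_lt (PosNum e0).
  by exists k; apply/ltW/(hk k)/leqnn.
have [[q r] _ /= hZ] := H k I.
apply: (@le_trans _ _ (Z n (D q) (D r) w)%:E).
  by rewrite -EFinB lee_fin ltW// (le_lt_trans _ hZ)// lerD2l lerN2.
apply: ereal_sup_ubound; exists (D q); first by rewrite /= in_itv/= D_itv.
by exists (D r) => //; rewrite /= in_itv/= D_itv.
Qed.

Lemma clock_lower_cvg0 : P [set w | th t0 w < k.+1%:R^-1] @[k --> \oo] --> 0%E.
Proof.
apply: (@eventually_notin_cvg0 _ _ _ P _ N) => //.
  move=> k.
  rewrite (_ : [set _ | _] = [set w | - k.+1%:R^-1 < - th t0 w]).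
    apply: measurable_cst_lt; apply: measurableT_comp => //; exact: measurable_clock.
  by apply/seteqP; split => w /=; rewrite ltrN2.
move=> w Nw; have [k0 _ hk] := near_infty_natSinv_lt (PosNum (clock_pos Nw)).
by exists k0 => // k /= k0k; apply/negP; rewrite -leNgt ltW// hk.
Qed.

(** When the clock at t0 exceeds 1 / k.+1 and the realized variation is
    uniformly close to the clock, uniform continuity of psi keeps the copula
    error below eps / 2. *)
Lemma copula_deviation_cvg0 eps : 0 < eps ->
  P (copula_deviation eps n) @[n --> \oo] --> 0%E.
Proof.
move=> eps0.
(* The event is known to be measurable for n > 0; the shift discards n = 0. *)
rewrite -(cvg_shiftS (fun n => P (copula_deviation eps n))).
apply: prob_cvg0P => [n|e e0]; first exact: measurable_copula_deviation.
have e20 : 0 < e / 2 by rewrite divr_gt0.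
have [k _ /(_ k (leqnn k)) Hk] := prob_cvg0_le clock_lower_cvg0 e20.
have al0 : 0 < k.+1%:R^-1 :> R by rewrite invr_gt0.
have eps20 : 0 < eps / 2 by rewrite divr_gt0.
have [rho rho0 Hrho] := psi_uniformly_continuous u01 v01 al0 eps20.
have tmax0 : 0 <= tmax by rewrite (le_trans t00)// ltW.
have [n0 _ Hn] := realized_variation_ucp tmax0 rho0 e20.
exists n0 => // n /= n0n.
have [B mB [PB HB]] := Hn n.+1 (leqW n0n).
pose L := [set w | th t0 w < k.+1%:R^-1].
have mL : measurable L.
  rewrite (_ : L = [set w | - k.+1%:R^-1 < - th t0 w]).
    apply: measurable_cst_lt; apply: measurableT_comp => //; exact: measurable_clock.
  by apply/seteqP; split => w /=; rewrite ltrN2.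
apply: (@le_trans _ _ (P (N `|` L `|` B))).
  rewrite le_measure ?inE//; first exact: measurable_copula_deviation.
    by do 2 apply: measurableU => //.
  move=> w Dw; apply: contrapT => NLB.
  have Nw : ~ N w by move=> Nw; apply: NLB; left; left.
  have Lw : k.+1%:R^-1 <= th t0 w.
    by rewrite leNgt; apply/negP => Lw; apply: NLB; left; right.
  have Bw : ~ B w by move=> Bw; apply: NLB; right.
  move: Dw; apply/negP; rewrite -ltNge; apply: (@le_lt_trans _ _ (eps / 2)%:E).
    apply: ge_ereal_sup => _ [s /= sI [t tI <-]].
    move: sI tI; rewrite !in_itv/= => /andP[s0 s1] /andP[t1 t2].
    rewrite lee_fin /Z; apply: Hrho.
    - by apply: clock_ge0; exact: le_trans s0.
    - by apply: clock_ge0; exact: le_trans t1.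
    - exact: realized_variation_ge0.
    - exact: realized_variation_ge0.
    - by rewrite (le_trans Lw)// le_max clock_mono.
    - by rewrite distrC HB// s1 (le_trans t00).
    - by rewrite distrC HB// t2 (le_trans t00).
  by rewrite lte_fin ltr_pdivrMr// ltr_pMr// ltr1n.
apply: le_trans (measureU2 _ _ _) _ => //; first by apply: measurableU.
rewrite (splitr e) EFinD; apply: leeD; last exact: PB.
apply: le_trans (measureU2 _ _ _) _ => //.
by rewrite [X in (X + _)%E]N0 add0e.
Qed.

End copula_estimation.

End time_change.

(** * Consistency of the copula estimator *)

Lemma ae_null_set d (Om : measurableType d) (R : realType) (P : probability Om R)
    (Q : Om -> Prop) : P.-negligible `<=` measurable -> {ae P, forall w, Q w} ->
  exists N, [/\ measurable N, P N = 0%E & forall w, ~ N w -> Q w].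
Proof.
move=> complete aeQ; exists (~` [set w | Q w]); split.
- exact: complete.
- by apply/negligibleP => //; exact: complete.
- by move=> w /contrapT.
Qed.

(** A stopping time is nonnegative, so the sets where it is at most some
    nonnegative r determine its measurability. *)
Lemma stopping_time_measurable d (Om : measurableType d) (R : realType)
    (F : R -> set (set Om)) (tau : Om -> \bar R) :
  filtration F -> stopping_time F tau -> measurable_fun setT tau.
Proof.
move=> [Fm _] [tau0 tauF].
apply: (measurability _ (ErealGenOInfty.measurableE R)) => _ [_ [r ->] <-].
rewrite setTI; have [r0|r0] := leP 0 r.
  rewrite (_ : _ @^-1` _ = ~` [set w | (tau w <= r%:E)%E]).
    by apply: measurableC; apply: (Fm _ r0).2; exact: tauF.
  by apply/seteqP; split => w /=; rewrite in_itv/= andbT ltNge => /negP.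
rewrite (_ : _ @^-1` _ = setT); first exact: measurableT.
apply/seteqP; split => w //= _; rewrite in_itv/= andbT.
by apply: lt_le_trans (tau0 w); rewrite lte_fin.
Qed.

Theorem theorem1 (d : measure_display) (Om : measurableType d) (R : realType)
    (P : probability Om R) (F : R -> set (set Om))
    (W : R -> Om -> R) (T : R -> Om -> \bar R) (t0 : R)
    (F_filtration : filtration F)
    (F_usual : usual_conditions P F)
    (W_BM : standard_brownian_motion P W)
    (T_time_change : continuous_time_change P F T)
    (W_T_indep : independent_processes P W T)
    (T_start : {ae P, forall w, T 0 w = 0%E})
    (T_finite : {ae P, forall w, forall t, 0 <= t -> (T t w < +oo)%E})
    (t0_ge0 : 0 <= t0)
    (T_t0_pos : P [set w | (0 < T t0 w)%E] = 1%E) :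
  forall u v : R, 0 <= u <= 1 -> 0 <= v <= 1 ->
  forall tmax : R, t0 < tmax ->
  forall eps : R, 0 < eps ->
  P [set w | (eps%:E <=
       ereal_sup [set `|cond_copula T s t u v w
                        - copula_estimator (time_changed W T) n s t u v w|%:E
                 | s in `[t0, tmax] & t in `[t0, tmax]])%E]
    @[n --> \oo] --> 0%E.
Proof.
move=> u v u01 v01 tmax t0max eps eps0.
have complete : P.-negligible `<=` measurable.
  by move=> A /(F_usual.2); exact: (F_filtration.1 0 (lexx 0)).2.
have [T_stop T_mono T_cont] := T_time_change.
have mT t : 0 <= t -> measurable_fun setT (T t).
  by move=> /T_stop; exact: stopping_time_measurable.
have T_pos : {ae P, forall w, (0 < T t0 w)%E}.
  have mpos : measurable [set w | (0 < T t0 w)%E].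
    by rewrite -[X in measurable X]setTI; exact: emeasurable_fun_o_infty (mT _ t0_ge0) _.
  apply/negligibleP; first exact: measurableC.
  by have := probability_setC P mpos; rewrite T_t0_pos subee.
have W_cont : {ae P, forall w, {within `[0, +oo[, continuous (fun t : R => W t w)}}.
  by case: W_BM.
have [N [mN N0 HN]] := ae_null_set complete (filterI T_mono (filterI T_cont
  (filterI T_start (filterI T_finite (filterI W_cont T_pos))))).
apply: (@copula_deviation_cvg0 _ _ _ P W T N complete W_BM _ mT W_T_indep mN N0
  _ _ _ _ _ u v t0 tmax u01 v01 t0_ge0 t0max _ eps eps0).
- by move=> t w t0'; case: (T_stop t t0').
- by move=> w /HN[].
- by move=> w /HN[_ []].
- by move=> w /HN[_ [_ []]].
- by move=> w /HN[_ [_ [_ []]]].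
- by move=> w /HN[_ [_ [_ [_ []]]]].
- by move=> w /HN[_ [_ [_ [_ []]]]].
Qed.
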